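(* Let $E: BL_+(\mathbb{R})\to \mathrm{Hom}(\mathbb{H})$ be an admissible extension. Assume there are $z_0\in\mathbb{H}$, $\varepsilon_0\in(0,1)$ and a linear functional $\Lambda: C^\infty_c(\mathbb{R})\to\mathbb{C}$ such that $$E(\mathrm{Id}+\varphi)(z_0)=z_0+\Lambda(\varphi)$$ for every $\varphi\in\mathcal{B}_\infty(\varepsilon_0)$. Then there exist $a\in\mathbb{R}$ and $\alpha\ge 0$ such that $E=\mathcal{E}_{a,\alpha}$, i.e. $Ef(z)=\mathcal{E}_{a,\alpha}f(z)$ for all $f\in BL_+(\mathbb{R})$ and all $z\in\mathbb{H}$.
   Context: $\mathbb{H}=\{z=x+iy: x\in\mathbb{R},\ y>0\}$. $\mathrm{Hom}(\mathbb{H})$ is the class of homeomorphisms of $\mathbb{H}$ onto itself. $\mathrm{Id}$ is the identity function. $BL_+(\mathbb{R})$ is the set of $f\in C^1(\mathbb{R})$, $f:\mathbb{R}\to\mathbb{R}$, for which there are $b,B>0$ with $b\le f'(x)\le B$ for all $x\in\mathbb{R}$. For $f_n,f\in BL_+(\mathbb{R})$ write $f_n\xrightarrow{BL_+(\mathbb{R})}f$ if $f_n\to f$ and $f_n'\to f'$ uniformly on compact sets of $\mathbb{R}$ and there are $b,B>0$ such that $b\le f_n'(x)\le B$ for all $n\ge1$ and $x\in\mathbb{R}$. A map $E:BL_+(\mathbb{R})\to\mathrm{Hom}(\mathbb{H})$ is an admissible extension if: (P1) for every $f\in BL_+(\mathbb{R})$, $\lim_{y\to0^+}Ef(x+iy)=f(x)$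 uniformly for $x$ in compact sets of $\mathbb{R}$; (P2) $E(a\,\mathrm{Id}+b)(z)=az+b$ for every $a>0$, $b\in\mathbb{R}$; (P3) $E(f\circ g)=Ef\circ Eg$ for all $f,g\in BL_+(\mathbb{R})$; (P4) if $f_n\xrightarrow{BL_+(\mathbb{R})}f$ then $Ef_n(z)\to Ef(z)$ for all $z\in\mathbb{H}$. $C^\infty_c(\mathbb{R})$ is the real vector space of infinitely differentiable compactly supported functions $\varphi:\mathbb{R}\to\mathbb{R}$, and $\mathcal{B}_\infty(\varepsilon)=\{\varphi\in C^\infty_c(\mathbb{R}):\|\varphi'\|_\infty<\varepsilon\}$. For $a\in\mathbb{R}$, $\alpha>0$ and $z=x+iy\in\mathbb{H}$, $$\mathcal{E}_{a,\alpha}f(z)=(1-\tfrac a\alpha)f(x+ay)+\tfrac a\alpha f(x-(\alpha-a)y)+\tfrac i\alpha f(x+ay)-\tfrac i\alpha f(x-(\alpha-a)y),$$ and for $\alpha=0$, $$\mathcal{E}_{a,0}f(z)=f(x+ay)-ay f'(x+ay)+iyf'(x+ay).$$ *)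

(* Defs.v *)
From Stdlib Require Import Reals.
From Coquelicot Require Import Coquelicot.
Open Scope R_scope.

Definition UH (z : C) : Prop := 0 < Im z.

(* Homeomorphisms of the upper half-plane are total maps on [C], constrained
   only on [UH]; [continuous_on] is continuity for the subspace topology. *)
Definition homeo_UH (F : C -> C) : Prop :=
  exists G : C -> C,
    (forall z, UH z -> UH (F z)) /\
    (forall z, UH z -> UH (G z)) /\
    (forall z, UH z -> G (F z) = z) /\
    (forall z, UH z -> F (G z) = z) /\
    continuous_on UH F /\
    continuous_on UH G.

Definition continuously_differentiable (f : R -> R) : Prop :=
  (forall x, ex_derive f x) /\ (forall x, continuous (Derive f) x).

Definition BL_plus (f : R -> R) : Prop :=
  continuously_differentiable f /\
  exists b B : R, 0 < b /\ 0 < B /\ forall x, b <= Derive f x <= B.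

Definition cvg_unif_compact (fn : nat -> R -> R) (f : R -> R) : Prop :=
  forall K : R -> Prop, compact K ->
  forall eps : R, 0 < eps ->
  exists N : nat, forall n : nat, (N <= n)%nat ->
  forall x, K x -> Rabs (fn n x - f x) < eps.

(* Sequences are indexed from 0. *)
Definition cvg_BL_plus (fn : nat -> R -> R) (f : R -> R) : Prop :=
  (forall n, BL_plus (fn n)) /\ BL_plus f /\
  cvg_unif_compact fn f /\
  cvg_unif_compact (fun n => Derive (fn n)) (Derive f) /\
  exists b B : R, 0 < b /\ 0 < B /\
    forall (n : nat) (x : R), b <= Derive (fn n) x <= B.

Definition boundary_values (E : (R -> R) -> C -> C) : Prop :=
  forall f, BL_plus f ->
  forall K : R -> Prop, compact K ->
  forall eps : R, 0 < eps ->
  exists delta : R, 0 < delta /\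
  forall x y : R, K x -> 0 < y < delta ->
  Cmod (E f (x, y) - RtoC (f x))%C < eps.

Definition extends_affine (E : (R -> R) -> C -> C) : Prop :=
  forall a b : R, 0 < a ->
  forall z, UH z -> E (fun x => a * x + b) z = (RtoC a * z + RtoC b)%C.

Definition multiplicative (E : (R -> R) -> C -> C) : Prop :=
  forall f g, BL_plus f -> BL_plus g ->
  forall z, UH z -> E (fun x => f (g x)) z = E f (E g z).

Definition sequentially_continuous (E : (R -> R) -> C -> C) : Prop :=
  forall fn f, cvg_BL_plus fn f ->
  forall z, UH z ->
  filterlim (fun n => E (fn n) z) eventually (locally (E f z)).

(* A map from [BL_plus] to homeomorphisms of [UH] is a total map whose values
   are constrained (and later compared) only on [BL_plus] and [UH]. *)
Definition admissible_extension (E : (R -> R) -> C -> C) : Prop :=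
  (forall f, BL_plus f -> homeo_UH (E f)) /\
  boundary_values E /\
  extends_affine E /\
  multiplicative E /\
  sequentially_continuous E.

Definition Cc_infty (phi : R -> R) : Prop :=
  (forall (n : nat) (x : R), ex_derive_n phi n x) /\
  compact (adherence (fun x => phi x <> 0)).

Definition sup_norm (g : R -> R) : Rbar :=
  Lub_Rbar (fun r => exists x, r = Rabs (g x)).

Definition B_infty (eps : R) (phi : R -> R) : Prop :=
  Cc_infty phi /\ Rbar_lt (sup_norm (Derive phi)) eps.

(* Real-linear functionals on [Cc_infty]; values elsewhere are irrelevant. *)
Definition linear_functional (L : (R -> R) -> C) : Prop :=
  (forall phi psi, Cc_infty phi -> Cc_infty psi ->
     L (fun x => phi x + psi x) = (L phi + L psi)%C) /\
  (forall (c : R) phi, Cc_infty phi ->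
     L (fun x => c * phi x) = (RtoC c * L phi)%C).

Definition calE_pos (a alpha : R) (f : R -> R) (z : C) : C :=
  let x := Re z in let y := Im z in
  let p := RtoC (f (x + a * y)) in
  let q := RtoC (f (x - (alpha - a) * y)) in
  ((1 - a / alpha) * p + a / alpha * q + Ci / alpha * p - Ci / alpha * q)%C.

Definition calE_zero (a : R) (f : R -> R) (z : C) : C :=
  let x := Re z in let y := Im z in
  let p := f (x + a * y) in
  let dp := Derive f (x + a * y) in
  (p - a * y * dp + Ci * y * dp)%C.

(* Meaningful for [0 <= alpha]. *)
Definition calE (a alpha : R) (f : R -> R) (z : C) : C :=
  if Req_EM_T alpha 0 then calE_zero a f z else calE_pos a alpha f z.

(* Main.v *)
Require Import Defs.
From Stdlib Require Import Reals Lra Lia FunctionalExtensionality IndefiniteDescription.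
From Coquelicot Require Import Coquelicot.
Open Scope R_scope.

(** Maps fixing z0 can be composed without changing values at z0, so ker L is
    invariant under [phi |-> phi o (Id + t psi)] for [psi] in ker L; taking [phi]
    quadratic near the support of [psi] shows that ker L is stable under
    multiplication by x.  Since ker L has real codimension 2, it contains all
    multiples of a quadratic polynomial p.  Its roots r >= s are real (otherwise one
    could divide by p and L would vanish), so L(phi) only depends on the affine Hermite
    interpolant of phi at r and s; continuity of E on cut-offs of affine maps
    identifies L(phi) as the value of that interpolant at z0.  This is the asserted
    formula near the identity, and composition of maps near the identity, transported
    by affine maps to all base points, reaches every f. *)

(** * Smooth functions *)

(** No continuity of [L] is given, so its kernel is handled by algebra alone and every limit has to
    pass through [E], inside the range of slopes where [E] is linear at [z0]. The functions 1 and x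
    that span the interpolants are not compactly supported. They enter through dilated cut-offs,
    which multiply a slope bound by at most [1 + 3 * K], uniformly in the scale, where [K] bounds
    the slope of the fixed bump [plateau]; this is the origin of the constant
    [eps0 / (2 * (1 + 3 * K))]. The passage from one point and small perturbations to all points and
    maps rests on the fact that [calE a alpha] shares three properties with [E]: it respects
    composition, it has the same values on increasing affine maps, and it is continuous along
    [cvg_BL_plus]. Agreement of the two therefore spreads through products and limits. *)

Fixpoint diffn (n : nat) (f : R -> R) : Prop :=
  match n with
  | O => True
  | S m => exists f', (forall x, is_derive f x (f' x)) /\ diffn m f'
  end.

(** The derivatives are carried as witnesses in [diffn], so closure under products, composition and
    inversion is a plain induction on the order. [smooth_iff] gives the agreement with
    [ex_derive_n]. *)
Definition smooth (f : R -> R) : Prop := forall n, diffn n f.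

Lemma is_derive_Derive_eq (f f' : R -> R) :
  (forall x, is_derive f x (f' x)) -> Derive f = f'.
Proof.
intros H; apply functional_extensionality; intros x.
now apply is_derive_unique.
Qed.

Lemma diffn_pred n f : diffn (S n) f -> diffn n f.
Proof.
revert f; induction n as [|n IH]; intros f; [easy|].
intros [f' [H1 H2]]; exists f'; split; [easy|]; now apply IH.
Qed.

Lemma diffn_const n c : diffn n (fun _ => c).
Proof.
revert c; induction n as [|n IH]; intros c; [easy|].
exists (fun _ => 0); split; [|apply IH].
intros x; apply @is_derive_const.
Qed.

Lemma diffn_id n : diffn n (fun x => x).
Proof.
destruct n; [easy|]; exists (fun _ => 1); split; [|apply diffn_const].
intros x; apply @is_derive_id.
Qed.

Lemma diffn_plus n f g : diffn n f -> diffn n g -> diffn n (fun x => f x + g x).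
Proof.
revert f g; induction n as [|n IH]; intros f g; [easy|].
intros [f' [Hf Hf']] [g' [Hg Hg']].
exists (fun x => f' x + g' x); split; [|now apply IH].
intros x; now apply @is_derive_plus.
Qed.

Lemma diffn_mult n f g : diffn n f -> diffn n g -> diffn n (fun x => f x * g x).
Proof.
revert f g; induction n as [|n IH]; intros f g; [easy|].
intros Hf Hg.
assert (Hf0 := diffn_pred _ _ Hf); assert (Hg0 := diffn_pred _ _ Hg).
destruct Hf as [f' [Hf Hf']], Hg as [g' [Hg Hg']].
exists (fun x => f' x * g x + f x * g' x); split.
- intros x; apply (is_derive_mult f g x); auto.
  intros; apply Rmult_comm.
- apply diffn_plus; now apply IH.
Qed.

Lemma diffn_comp n f g : diffn n f -> diffn n g -> diffn n (fun x => f (g x)).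
Proof.
revert f g; induction n as [|n IH]; intros f g; [easy|].
intros [f' [Hf Hf']] Hg.
assert (Hg0 := diffn_pred _ _ Hg).
destruct Hg as [g' [Hg Hg']].
exists (fun x => g' x * f' (g x)); split.
- intros x; now apply (is_derive_comp f g x).
- apply diffn_mult; auto.
Qed.

Lemma diffn_inv n f : (forall x, f x <> 0) -> diffn n f -> diffn n (fun x => / f x).
Proof.
intros Hnz; revert f Hnz; induction n as [|n IH]; intros f Hnz; [easy|].
intros Hf; assert (Hf0 := diffn_pred _ _ Hf).
destruct Hf as [f' [Hf Hf']].
(* The inverse square is written as a product of two inverses so that the induction hypothesis
   applies to each factor. *)
exists (fun x => (-1) * f' x * (/ f x * / f x)); split.
- intros x; replace (-1 * f' x * (/ f x * / f x)) with (- f' x / f x ^ 2)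
    by (field; apply Hnz).
  now apply is_derive_inv.
- apply diffn_mult; [apply diffn_mult; [apply diffn_const|easy]|].
  apply diffn_mult; now apply IH.
Qed.

Lemma smooth_const c : smooth (fun _ => c).
Proof. intros n; apply diffn_const. Qed.
Lemma smooth_id : smooth (fun x => x).
Proof. intros n; apply diffn_id. Qed.
Lemma smooth_plus f g : smooth f -> smooth g -> smooth (fun x => f x + g x).
Proof. intros Hf Hg n; now apply diffn_plus. Qed.
Lemma smooth_mult f g : smooth f -> smooth g -> smooth (fun x => f x * g x).
Proof. intros Hf Hg n; now apply diffn_mult. Qed.
Lemma smooth_comp f g : smooth f -> smooth g -> smooth (fun x => f (g x)).
Proof. intros Hf Hg n; now apply diffn_comp. Qed.
Lemma smooth_inv f : (forall x, f x <> 0) -> smooth f -> smooth (fun x => / f x).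
Proof. intros Hnz Hf n; now apply diffn_inv. Qed.

Lemma smooth_opp f : smooth f -> smooth (fun x => - f x).
Proof.
intros Hf; replace (fun x => - f x) with (fun x => (-1) * f x).
- apply smooth_mult; [apply smooth_const|easy].
- apply functional_extensionality; intros x; ring.
Qed.

Lemma smooth_minus f g : smooth f -> smooth g -> smooth (fun x => f x - g x).
Proof. intros; apply smooth_plus; [easy|now apply smooth_opp]. Qed.

Lemma smooth_primitive f f' :
  (forall x, is_derive f x (f' x)) -> smooth f' -> smooth f.
Proof. intros H H' [|n]; [easy|]; exists f'; split; [easy|apply H']. Qed.

Lemma smooth_is_derive f : smooth f -> forall x, is_derive f x (Derive f x).
Proof.
intros Hf x; destruct (Hf 1%nat) as [f' [H _]].
apply Derive_correct; now exists (f' x).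
Qed.

Lemma smooth_Derive f : smooth f -> smooth (Derive f).
Proof.
intros Hf n; destruct (Hf (S n)) as [f' [H1 H2]].
now rewrite (is_derive_Derive_eq _ _ H1).
Qed.

Lemma smooth_Derive_n f n : smooth f -> smooth (Derive_n f n).
Proof.
intros Hf; induction n as [|n IH]; simpl; [exact Hf|].
apply (smooth_Derive _ IH).
Qed.

Lemma smooth_iff f : smooth f <-> forall n x, ex_derive_n f n x.
Proof.
split.
- intros Hf [|n] x; [easy|]; simpl.
  exists (Derive (Derive_n f n) x).
  now apply smooth_is_derive, smooth_Derive_n.
- intros Hf n.
  enough (H : forall n k, diffn n (Derive_n f k)) by apply (H n 0%nat).
  clear n; induction n as [|n IH]; intros k; [easy|].
  exists (Derive_n f (S k)); split; [|apply IH].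
  intros x; simpl; apply Derive_correct, (Hf (S k) x).
Qed.

Lemma is_derive_continuous (f : R -> R) x l : is_derive f x l -> continuous f x.
Proof. intros H; apply (ex_derive_continuous f x); now exists l. Qed.

Lemma smooth_continuous f : smooth f -> forall x, continuous f x.
Proof. intros Hf x; eapply is_derive_continuous, smooth_is_derive, Hf. Qed.

Lemma smooth_RInt f : smooth f -> forall a x, is_derive (fun y => RInt f a y) x (f x).
Proof.
intros Hf a x; apply @is_derive_RInt with a.
- apply filter_forall; intros y; apply (RInt_correct f a y).
  apply (ex_RInt_continuous (V := R_CompleteNormedModule)).
  intros z _; now apply smooth_continuous.
- now apply smooth_continuous.
Qed.

(** * Cut-off functions and division of smooth functions *)

(** Meant for parameter integrals, whose successive derivatives are again explicit integrals. *)
Lemma smooth_derivative_sequence (F : nat -> R -> R) :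
  (forall k x, is_derive (F k) x (F (S k) x)) -> forall k, smooth (F k).
Proof.
intros H k n; revert k; induction n as [|n IH]; intros k; [easy|].
exists (F (S k)); split; [apply H|apply IH].
Qed.

(** The powers of [/ x] are there to make the family closed under differentiation: the derivative of
    member k is member k+2 minus k times member k+1. Smoothness of [flat 0] then follows by an
    induction that treats all k at once. *)
Definition flat (k : nat) (x : R) : R :=
  if Rle_dec x 0 then 0 else (/ x) ^ k * exp (- / x).

Lemma flat_nonpos k x : x <= 0 -> flat k x = 0.
Proof. intros H; unfold flat; now destruct (Rle_dec x 0). Qed.

Lemma flat_pos_eq k x : 0 < x -> flat k x = (/ x) ^ k * exp (- / x).
Proof. intros H; unfold flat; destruct (Rle_dec x 0); [lra|easy]. Qed.

Lemma exp_INR_mult n x : exp (INR n * x) = exp x ^ n.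
Proof.
induction n as [|n IH]; [simpl; now rewrite Rmult_0_l, exp_0|].
rewrite S_INR, Rmult_plus_distr_r, Rmult_1_l, exp_plus, IH; simpl; ring.
Qed.

(** With [M = S m], the inequality [u / M <= exp (u / M)] raised to the power [M] gives
    [(u / M) ^ M <= exp u]. *)
Lemma pow_exp_opp_le (m : nat) (u : R) :
  0 < u -> u ^ S m * exp (- u) <= INR (S m) ^ S m.
Proof.
intros Hu; set (M := INR (S m)).
assert (HM : 0 < M) by (apply lt_0_INR; lia).
assert (E : exp u = exp (u / M) ^ S m).
{ rewrite <- exp_INR_mult; f_equal; fold M; field; lra. }
assert (H : (u / M) ^ S m <= exp u).
{ rewrite E; apply pow_incr; split.
  - apply Rlt_le, Rdiv_lt_0_compat; lra.
  - generalize (exp_ineq1_le (u / M)); lra. }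
rewrite exp_Ropp.
assert (He := exp_pos u).
apply Rmult_le_reg_r with (exp u); [easy|].
rewrite Rmult_assoc, Rinv_l, Rmult_1_r by lra.
replace (u ^ S m) with (M ^ S m * (u / M) ^ S m).
- apply Rmult_le_compat_l; [apply pow_le; lra|easy].
- rewrite <- Rpow_mult_distr; f_equal; field; lra.
Qed.

Lemma is_derive_flat k x :
  is_derive (flat k) x (flat (S (S k)) x - INR k * flat (S k) x).
Proof.
destruct (total_order_T x 0) as [[Hx|Hx]|Hx].
- rewrite !flat_nonpos by lra.
  apply is_derive_ext_loc with (fun _ => 0).
  + apply filter_imp with (fun y => y < 0).
    * intros y Hy; rewrite flat_nonpos; lra.
    * now apply (open_lt 0).
  + replace (0 - INR k * 0) with 0 by ring; apply @is_derive_const.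
- subst x; rewrite !flat_nonpos by lra.
  apply is_derive_Reals; intros eps Heps.
  set (C := INR (S (S k)) ^ S (S k)).
  assert (HC : 0 < C) by (apply pow_lt, lt_0_INR; lia).
  (* For [h > 0] the difference quotient at 0 is [(/ h) ^ (k + 2) * exp (- / h) * h], which is at
     most [C * h] by [pow_exp_opp_le]. *)
  assert (Hd : 0 < eps / C) by now apply Rdiv_lt_0_compat.
  exists (mkposreal _ Hd); intros h Hh Hhd; simpl in Hhd.
  rewrite Rplus_0_l, (flat_nonpos k 0) by lra.
  destruct (Rle_dec h 0) as [Hh0|Hh0].
  + rewrite flat_nonpos by lra.
    replace ((0 - 0) / h - (0 - INR k * 0)) with 0 by (field; lra).
    rewrite Rabs_R0; lra.
  + assert (Hp : 0 < h) by lra; rewrite flat_pos_eq by lra.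
    replace (((/ h) ^ k * exp (- / h) - 0) / h - (0 - INR k * 0))
      with (((/ h) ^ S (S k) * exp (- / h)) * h) by (simpl; field; lra).
    assert (Hi : 0 < / h) by now apply Rinv_0_lt_compat.
    assert (Hb := pow_exp_opp_le (S k) (/ h) Hi); fold C in Hb.
    assert (0 <= (/ h) ^ S (S k) * exp (- / h)).
    { apply Rmult_le_pos; [apply pow_le; lra|apply Rlt_le, exp_pos]. }
    rewrite Rabs_pos_eq by (apply Rmult_le_pos; lra).
    rewrite Rabs_pos_eq in Hhd by lra.
    apply Rle_lt_trans with (C * h); [apply Rmult_le_compat_r; lra|].
    apply Rmult_lt_reg_r with (/ C); [now apply Rinv_0_lt_compat|].
    replace (C * h * / C) with h by (field; lra); exact Hhd.
- assert (Hp : 0 < x) by lra; rewrite !flat_pos_eq by lra.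
  apply is_derive_ext_loc with (fun y => (/ y) ^ k * exp (- / y)).
  + apply filter_imp with (fun y => 0 < y).
    * intros y Hy; now rewrite flat_pos_eq.
    * now apply (open_gt 0).
  + auto_derive; [lra|]. destruct k as [|k]; [simpl; field; lra|]. rewrite S_INR. simpl. field; lra.
Qed.

Lemma smooth_flat : smooth (flat 0).
Proof.
intros n; generalize 0%nat; induction n as [|n IH]; intros k; [easy|].
eexists; split; [apply is_derive_flat|].
apply diffn_plus; [apply IH|].
replace (fun x => - (INR k * flat (S k) x)) with (fun x => (- INR k) * flat (S k) x)
  by (apply functional_extensionality; intros; ring).
apply diffn_mult; [apply diffn_const|apply IH].
Qed.

Definition step (x : R) : R := flat 0 x * / (flat 0 x + flat 0 (1 - x)).

Lemma flat_ge0 k x : 0 <= flat k x.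
Proof.
unfold flat; destruct (Rle_dec x 0); [lra|].
apply Rmult_le_pos; [apply pow_le, Rlt_le, Rinv_0_lt_compat; lra|].
apply Rlt_le, exp_pos.
Qed.

Lemma flat0_gt0 x : 0 < x -> 0 < flat 0 x.
Proof. intros H; rewrite flat_pos_eq by easy; simpl; rewrite Rmult_1_l; apply exp_pos. Qed.

Lemma step_denominator_pos x : 0 < flat 0 x + flat 0 (1 - x).
Proof.
assert (H1 := flat_ge0 0 x); assert (H2 := flat_ge0 0 (1 - x)).
destruct (Rle_dec x 0).
- assert (0 < flat 0 (1 - x)) by (apply flat0_gt0; lra); lra.
- assert (0 < flat 0 x) by (apply flat0_gt0; lra); lra.
Qed.

Lemma step_left x : x <= 0 -> step x = 0.
Proof. intros H; unfold step; rewrite flat_nonpos by easy; ring. Qed.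

Lemma step_right x : 1 <= x -> step x = 1.
Proof.
intros H; unfold step; generalize (step_denominator_pos x).
rewrite (flat_nonpos 0 (1 - x)) by lra; intros; field; lra.
Qed.

Lemma step_bounds x : 0 <= step x <= 1.
Proof.
unfold step; assert (H := step_denominator_pos x).
assert (H1 := flat_ge0 0 x); assert (H2 := flat_ge0 0 (1 - x)).
split.
- apply Rmult_le_pos; [easy|]; now apply Rlt_le, Rinv_0_lt_compat.
- apply Rmult_le_reg_r with (flat 0 x + flat 0 (1 - x)); [easy|].
  rewrite Rmult_assoc, Rinv_l; lra.
Qed.

Lemma smooth_step : smooth step.
Proof.
unfold step.
assert (H : smooth (fun x => flat 0 (1 - x))).
{ apply (smooth_comp (flat 0) (fun x => 1 - x)); [apply smooth_flat|].
  apply smooth_minus; [apply smooth_const|apply smooth_id]. }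
apply smooth_mult; [apply smooth_flat|].
apply (smooth_inv (fun x => flat 0 x + flat 0 (1 - x))).
- intros x; generalize (step_denominator_pos x); lra.
- apply smooth_plus; [apply smooth_flat|easy].
Qed.

Definition plateau (x : R) : R := step (2 + x) * step (2 - x).

Lemma smooth_plateau : smooth plateau.
Proof.
apply smooth_mult; apply (smooth_comp step); try apply smooth_step.
- apply smooth_plus; [apply smooth_const|apply smooth_id].
- apply smooth_minus; [apply smooth_const|apply smooth_id].
Qed.

Lemma plateau_eq1 x : Rabs x <= 1 -> plateau x = 1.
Proof.
intros H; apply Rabs_le_between in H; unfold plateau.
rewrite !step_right; lra.
Qed.

Lemma plateau_eq0 x : 2 <= Rabs x -> plateau x = 0.
Proof.
unfold plateau, Rabs; destruct (Rcase_abs x); intros H.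
- rewrite (step_left (2 + x)) by lra; ring.
- rewrite (step_left (2 - x)) by lra; ring.
Qed.

Lemma plateau_bounds x : 0 <= plateau x <= 1.
Proof.
unfold plateau; assert (H1 := step_bounds (2 + x)).
assert (H2 := step_bounds (2 - x)); split; nra.
Qed.

Lemma continuous_bounded_on (f : R -> R) M :
  (forall x, continuous f x) ->
  exists K, 0 <= K /\ forall x, Rabs x <= M -> Rabs (f x) <= K.
Proof.
intros Hc; destruct (Rle_dec 0 M) as [HM|HM].
- assert (Hab : - M <= M) by lra.
  destruct (continuity_ab_maj (fun x => Rabs (f x)) (- M) M Hab) as [m [Hm _]].
  + intros c _; apply continuity_pt_filterlim.
    apply (continuous_comp f Rabs); [apply Hc|apply continuous_Rabs].
  + exists (Rabs (f m)); split; [apply Rabs_pos|].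
    intros x Hx; apply Hm; now apply Rabs_le_between.
- exists 0; split; [lra|]; intros x Hx; generalize (Rabs_pos x); lra.
Qed.

Lemma compact_support_bounded (f : R -> R) M :
  (forall x, continuous f x) -> (forall x, M < Rabs x -> f x = 0) ->
  exists K, 0 <= K /\ forall x, Rabs (f x) <= K.
Proof.
intros Hc H0; destruct (continuous_bounded_on f M Hc) as [K [HK H]].
exists K; split; [easy|]; intros x; destruct (Rle_dec (Rabs x) M); [now apply H|].
rewrite H0, Rabs_R0; lra.
Qed.

Lemma Derive_support (f : R -> R) M :
  (forall x, M < Rabs x -> f x = 0) -> forall x, M < Rabs x -> Derive f x = 0.
Proof.
intros H x Hx.
rewrite (Derive_ext_loc f (fun _ => 0)); [apply Derive_const|].
apply filter_imp with (fun y => M < Rabs y); [apply H|].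
apply (open_comp Rabs (fun y => M < y)); [|apply open_gt|easy].
intros y _; apply continuous_Rabs.
Qed.

Lemma plateau_slope_bound :
  exists K, 0 < K /\ forall x, Rabs (Derive plateau x) <= K.
Proof.
destruct (compact_support_bounded (Derive plateau) 2) as [K [HK H]].
- apply smooth_continuous, smooth_Derive, smooth_plateau.
- apply Derive_support; intros x Hx; apply plateau_eq0; lra.
- exists (K + 1); split; [lra|]; intros x; generalize (H x); lra.
Qed.

(** * Hadamard's lemma: smooth division by x - r *)

Section Hadamard.
Variables (g : R -> R) (r : R).
Hypothesis Hg : smooth g.

(** For k = 0 this is the mean of g' over the segment from r to x, that is, the difference quotient
    of g extended across r. For general k it is the k-th derivative of that quotient, taken under
    the integral sign. *)
Definition hadamard_quotient (k : nat) (x : R) : R :=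
  RInt (fun t => t ^ k * Derive_n g (S k) (r + t * (x - r))) 0 1.

Lemma is_derive_line_Derive_n k t x :
  is_derive (fun y => t ^ k * Derive_n g (S k) (r + t * (y - r))) x
    (t ^ S k * Derive_n g (S (S k)) (r + t * (x - r))).
Proof.
replace (t ^ S k * Derive_n g (S (S k)) (r + t * (x - r)))
  with (t ^ k * (t * Derive_n g (S (S k)) (r + t * (x - r)))) by (simpl; ring).
apply (is_derive_scal (fun y => Derive_n g (S k) (r + t * (y - r)))).
apply (is_derive_comp (Derive_n g (S k)) (fun y => r + t * (y - r))).
- exact (smooth_is_derive _ (smooth_Derive_n g (S k) Hg) _).
- auto_derive; [easy|ring].
Qed.

Lemma is_derive_hadamard_quotient k x :
  is_derive (hadamard_quotient k) x (hadamard_quotient (S k) x).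
Proof.
unfold hadamard_quotient at 2.
replace (fun t : R => t ^ S k * Derive_n g (S (S k)) (r + t * (x - r))) with
  (fun t => Derive (fun y => t ^ k * Derive_n g (S k) (r + t * (y - r))) x)
  by (apply functional_extensionality; intros t;
      apply is_derive_unique, is_derive_line_Derive_n).
apply (is_derive_RInt_param
  (fun y t => t ^ k * Derive_n g (S k) (r + t * (y - r))) 0 1 x).
- apply filter_forall; intros y t _; eexists; apply is_derive_line_Derive_n.
- intros t _.
  apply (continuity_2d_pt_ext
    (fun u v => v ^ S k * Derive_n g (S (S k)) (r + v * (u - r)))).
  + intros u v; symmetry; apply is_derive_unique, is_derive_line_Derive_n.
  + apply (continuity_2d_pt_mult (fun u v => v ^ S k)).
    * apply (continuity_1d_2d_pt_comp (fun v => v ^ S k) (fun u v => v)).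
      -- apply continuity_pt_filterlim, (smooth_continuous (fun v => v ^ S k)).
         intros n; clear; induction (S k) as [|m IH]; simpl; [apply diffn_const|].
         apply diffn_mult; [apply diffn_id|easy].
      -- apply continuity_2d_pt_id2.
    * apply (continuity_1d_2d_pt_comp (Derive_n g (S (S k)))
        (fun u v => r + v * (u - r))).
      -- apply continuity_pt_filterlim, smooth_continuous.
         exact (smooth_Derive_n g (S (S k)) Hg).
      -- apply continuity_2d_pt_plus; [apply continuity_2d_pt_const|].
         apply continuity_2d_pt_mult; [apply continuity_2d_pt_id2|].
         apply continuity_2d_pt_minus; [apply continuity_2d_pt_id1|].
         apply continuity_2d_pt_const.
- apply filter_forall; intros y.
  apply (ex_RInt_continuous (V := R_CompleteNormedModule)).
  intros t _; apply (smooth_continuous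
    (fun t => t ^ k * Derive_n g (S k) (r + t * (y - r)))).
  apply smooth_mult.
  + intros n; clear; induction k as [|m IH]; simpl; [apply diffn_const|].
    apply diffn_mult; [apply diffn_id|easy].
  + apply (smooth_comp (Derive_n g (S k))); [exact (smooth_Derive_n g (S k) Hg)|].
    apply smooth_plus; [apply smooth_const|].
    apply smooth_mult; [apply smooth_id|apply smooth_const].
Qed.

Lemma hadamard_quotient_mult x :
  hadamard_quotient 0 x * (x - r) = g x - g r.
Proof.
assert (H : is_RInt (fun t => (x - r) * (t ^ 0 * Derive_n g 1 (r + t * (x - r)))) 0 1
              (g x - g r)).
{ replace (g x - g r) with
    (minus (g (r + 1 * (x - r))) (g (r + 0 * (x - r))))
    by (replace (r + 1 * (x - r)) with x by ring;
        replace (r + 0 * (x - r)) with r by ring; easy).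
  apply (is_RInt_derive (fun t => g (r + t * (x - r)))).
  - intros t _.
    replace ((x - r) * (t ^ 0 * Derive_n g 1 (r + t * (x - r))))
      with ((x - r) * Derive g (r + t * (x - r)))
      by (change (Derive_n g 1) with (Derive g); simpl pow; ring).
    apply (is_derive_comp g (fun t => r + t * (x - r))).
    + now apply smooth_is_derive.
    + auto_derive; [easy|ring].
  - intros t _; apply (smooth_continuous
      (fun t => (x - r) * (t ^ 0 * Derive_n g 1 (r + t * (x - r))))).
    apply smooth_mult; [apply smooth_const|].
    apply smooth_mult; [exact (smooth_const 1)|].
    apply (smooth_comp (Derive_n g 1)); [exact (smooth_Derive_n g 1 Hg)|].
    apply smooth_plus; [apply smooth_const|].
    apply smooth_mult; [apply smooth_id|apply smooth_const]. }
rewrite <- (is_RInt_unique _ _ _ _ H).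
rewrite Rmult_comm; symmetry.
apply (RInt_scal (V := R_CompleteNormedModule)
  (fun t => t ^ 0 * Derive_n g 1 (r + t * (x - r))) 0 1 (x - r)).
apply (ex_RInt_continuous (V := R_CompleteNormedModule)).
intros t _; apply (smooth_continuous
  (fun t => t ^ 0 * Derive_n g 1 (r + t * (x - r)))).
apply smooth_mult; [exact (smooth_const 1)|].
apply (smooth_comp (Derive_n g 1)); [exact (smooth_Derive_n g 1 Hg)|].
apply smooth_plus; [apply smooth_const|].
apply smooth_mult; [apply smooth_id|apply smooth_const].
Qed.

End Hadamard.

(** The value of the quotient at r comes from differentiating [g = (x - r) h] there; it is what
    allows a double root to be divided out twice. *)
Lemma smooth_division (g : R -> R) r :
  smooth g -> g r = 0 ->
  exists h, smooth h /\ (forall x, g x = (x - r) * h x) /\ h r = Derive g r.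
Proof.
intros Hg Hr; exists (hadamard_quotient g r 0).
assert (Hs : smooth (hadamard_quotient g r 0)).
{ apply smooth_derivative_sequence; intros k x.
  now apply is_derive_hadamard_quotient. }
assert (Hm : forall x, g x = (x - r) * hadamard_quotient g r 0 x).
{ intros x; rewrite Rmult_comm, hadamard_quotient_mult by easy; rewrite Hr; ring. }
split; [easy|split; [easy|]].
symmetry; apply is_derive_unique.
apply is_derive_ext with (fun x => (x - r) * hadamard_quotient g r 0 x);
  [intros; now rewrite Hm|].
replace (hadamard_quotient g r 0 r) with
  (1 * hadamard_quotient g r 0 r + (r - r) * Derive (hadamard_quotient g r 0) r) by ring.
apply (is_derive_mult (fun x => x - r)).
- auto_derive; [easy|ring].
- now apply smooth_is_derive.
- intros; apply Rmult_comm.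
Qed.

(** * The class BL_plus *)

Definition bounded_support (f : R -> R) : Prop :=
  exists M, forall x, M < Rabs x -> f x = 0.

Lemma compact_bounded (K : R -> Prop) :
  compact K -> exists M, forall x, K x -> Rabs x <= M.
Proof.
intros HK; destruct (compact_P1 K HK) as [m [M H]].
exists (Rmax (Rabs m) (Rabs M)); intros x Hx.
apply Rabs_le_between; specialize (H x Hx).
assert (H1 := Rmax_l (Rabs m) (Rabs M)); assert (H2 := Rmax_r (Rabs m) (Rabs M)).
assert (H3 := Rle_abs M); assert (H4 := Rle_abs (- m)); rewrite Rabs_Ropp in H4.
lra.
Qed.

(** On the line the closed support is compact as soon as the set where [phi] is nonzero is bounded:
    a point of the closure outside [-M, M] would have a neighbourhood on which [phi] vanishes. *)
Lemma Cc_infty_iff phi : Cc_infty phi <-> smooth phi /\ bounded_support phi.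
Proof.
unfold Cc_infty; rewrite <- smooth_iff; split; intros [Hs Hc]; split; try easy.
- destruct (compact_bounded _ Hc) as [M HM]; exists M; intros x Hx.
  destruct (Req_dec (phi x) 0) as [H|H]; [easy|].
  specialize (HM x (adherence_P1 _ _ H)); lra.
- destruct Hc as [M HM].
  apply compact_P4 with (fun c => - M <= c <= M);
    [apply compact_P3|apply adherence_P3|].
  intros x Hx; apply Rabs_le_between; apply Rnot_lt_le; intros Hlt.
  assert (Hd : 0 < Rabs x - M) by lra.
  destruct (Hx (fun y => Rabs (y - x) < mkposreal _ Hd)) as [y [Hy1 Hy2]].
  + now exists (mkposreal _ Hd).
  + simpl in Hy1; apply Hy2, HM.
    assert (H := Rabs_triang_inv x y); rewrite Rabs_minus_sym in Hy1; lra.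
Qed.

(** The gap between [c] and [eps] matters: a strict pointwise bound by [eps] would bound the
    supremum only weakly. *)
Lemma B_infty_intro eps phi c :
  Cc_infty phi -> (forall x, Rabs (Derive phi x) <= c) -> c < eps ->
  B_infty eps phi.
Proof.
intros Hc Hb Hlt; split; [easy|].
apply Rbar_le_lt_trans with (Finite c); [|exact Hlt].
apply Lub_Rbar_correct; intros y [x ->]; apply Hb.
Qed.

Lemma Cc_infty_plus phi psi :
  Cc_infty phi -> Cc_infty psi -> Cc_infty (fun x => phi x + psi x).
Proof.
rewrite !Cc_infty_iff; intros [H1 [M1 HM1]] [H2 [M2 HM2]]; split;
  [now apply smooth_plus|].
exists (Rmax M1 M2); intros x Hx.
assert (H3 := Rmax_l M1 M2); assert (H4 := Rmax_r M1 M2).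
rewrite HM1, HM2; lra.
Qed.

Lemma Cc_infty_mult f phi :
  smooth f -> Cc_infty phi -> Cc_infty (fun x => f x * phi x).
Proof.
rewrite !Cc_infty_iff; intros H1 [H2 [M HM]]; split; [now apply smooth_mult|].
exists M; intros x Hx; rewrite HM by easy; ring.
Qed.

Lemma Cc_infty_scal c phi : Cc_infty phi -> Cc_infty (fun x => c * phi x).
Proof. apply (Cc_infty_mult (fun _ => c)), smooth_const. Qed.

Lemma Cc_infty_bounded phi :
  Cc_infty phi ->
  exists K, 0 < K /\ forall x, Rabs (phi x) <= K /\ Rabs (Derive phi x) <= K.
Proof.
rewrite Cc_infty_iff; intros [Hs [M HM]].
destruct (compact_support_bounded phi M) as [K1 [HK1 H1]];
  [now apply smooth_continuous|easy|].
destruct (compact_support_bounded (Derive phi) M) as [K2 [HK2 H2]];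
  [now apply smooth_continuous, smooth_Derive|now apply Derive_support|].
exists (K1 + K2 + 1); split; [lra|]; intros x.
generalize (H1 x) (H2 x); lra.
Qed.

Lemma MVT_all (f f' : R -> R) :
  (forall x, is_derive f x (f' x)) ->
  forall x y, exists c, Rmin x y <= c <= Rmax x y /\ f y - f x = f' c * (y - x).
Proof.
intros H x y; apply MVT_gen; [easy|].
intros z _; apply continuity_pt_filterlim.
now apply is_derive_continuous with (f' z).
Qed.

Lemma lipschitz_of_derive_bound (f f' : R -> R) K :
  (forall x, is_derive f x (f' x)) -> (forall x, Rabs (f' x) <= K) ->
  forall x y, Rabs (f y - f x) <= K * Rabs (y - x).
Proof.
intros H HK x y; destruct (MVT_all f f' H x y) as [c [_ ->]].
rewrite Rabs_mult; apply Rmult_le_compat_r; [apply Rabs_pos|apply HK].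
Qed.

(** Keeping the derivative and the two bounds explicit allows one pair of bounds to serve a whole
    sequence, as [cvg_BL_plus] requires. *)
Definition BL_with (b B : R) (f f' : R -> R) : Prop :=
  (forall x, is_derive f x (f' x)) /\ (forall x, continuous f' x) /\
  (forall x, b <= f' x <= B).

Lemma BL_with_Derive b B f f' : BL_with b B f f' -> Derive f = f'.
Proof. intros [H _]; now apply is_derive_Derive_eq. Qed.

Lemma BL_plus_intro b B f f' : 0 < b -> BL_with b B f f' -> BL_plus f.
Proof.
intros Hb H; assert (HD := BL_with_Derive _ _ _ _ H).
destruct H as [H1 [H2 H3]]; split; [split|].
- intros x; now exists (f' x).
- now rewrite HD.
- exists b, B; rewrite HD; split; [easy|split; [|easy]].
  generalize (H3 0); lra.
Qed.

Lemma BL_plus_elim f : BL_plus f ->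
  exists b B, 0 < b /\ BL_with b B f (Derive f).
Proof.
intros [[H1 H2] [b [B [Hb [HB H]]]]]; exists b, B; split; [easy|].
split; [|easy]; intros x; now apply Derive_correct.
Qed.

Lemma BL_plus_is_derive f : BL_plus f -> forall x, is_derive f x (Derive f x).
Proof. intros [[H _] _] x; now apply Derive_correct. Qed.

Lemma BL_plus_increasing f : BL_plus f -> forall x y, x < y -> f x < f y.
Proof.
intros Hf x y Hxy; destruct (BL_plus_elim f Hf) as [b [B [Hb [H1 [_ H2]]]]].
destruct (MVT_all _ _ H1 x y) as [c [_ Hc]]; specialize (H2 c).
assert (0 < Derive f c * (y - x)) by (apply Rmult_lt_0_compat; lra); lra.
Qed.

Lemma BL_plus_affine k m : 0 < k -> BL_plus (fun x => k * x + m).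
Proof.
intros Hk; apply (BL_plus_intro k k _ (fun _ => k)); [easy|].
split; [|split].
- intros x; auto_derive; [easy|ring].
- intros x; apply continuous_const.
- intros; lra.
Qed.

Lemma is_derive_BL_comp f g x : BL_plus f -> BL_plus g ->
  is_derive (fun x => f (g x)) x (Derive g x * Derive f (g x)).
Proof.
intros Hf Hg; apply (is_derive_comp f g x); now apply BL_plus_is_derive.
Qed.

Lemma BL_plus_continuous f : BL_plus f -> forall x, continuous f x.
Proof.
intros Hf x; apply is_derive_continuous with (Derive f x).
now apply BL_plus_is_derive.
Qed.

Lemma BL_plus_comp f g : BL_plus f -> BL_plus g -> BL_plus (fun x => f (g x)).
Proof.
intros Hf Hg.
destruct (BL_plus_elim f Hf) as [b [B [Hb [_ [Hf2 Hf3]]]]].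
destruct (BL_plus_elim g Hg) as [b' [B' [Hb' [_ [Hg2 Hg3]]]]].
apply (BL_plus_intro (b' * b) (B' * B) _ (fun x => Derive g x * Derive f (g x))).
- now apply Rmult_lt_0_compat.
- split; [|split].
  + intros x; now apply is_derive_BL_comp.
  + intros x; apply (continuous_mult (Derive g)); [easy|].
    apply (continuous_comp g (Derive f)); [now apply BL_plus_continuous|easy].
  + intros x; generalize (Hf3 (g x)) (Hg3 x); intros.
    split; apply Rmult_le_compat; lra.
Qed.

Lemma BL_plus_perturbation (phi : R -> R) c :
  (forall x, is_derive phi x (Derive phi x)) ->
  (forall x, continuous (Derive phi) x) ->
  (forall x, Rabs (Derive phi x) <= c) -> c < 1 -> BL_plus (fun x => x + phi x).
Proof.
intros H1 H2 H3 Hc.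
apply (BL_plus_intro (1 - c) (1 + c) _ (fun x => 1 + Derive phi x)); [lra|].
split; [|split].
- intros x; apply (is_derive_plus (fun x : R => x) phi x 1); [apply @is_derive_id|easy].
- intros x; apply (continuous_plus (fun _ : R => 1) (Derive phi)); [apply continuous_const|easy].
- intros x; specialize (H3 x); apply Rabs_le_between in H3; lra.
Qed.

Lemma BL_plus_surjective f : BL_plus f -> forall y, exists x, f x = y.
Proof.
intros Hf y; destruct (BL_plus_elim f Hf) as [b [B [Hb [H1 [_ H2]]]]].
assert (Hc : continuity f).
{ intros x; apply continuity_pt_filterlim; now apply BL_plus_continuous. }
(* Slopes are at least [b], so over [0, M] and [-M, 0] the function moves by at least [b * M], the
   distance from [f 0] to the target [y]. *)
set (M := Rabs (y - f 0) / b).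
assert (HM : 0 <= M) by (apply Rmult_le_pos; [apply Rabs_pos|]; left; now apply Rinv_0_lt_compat).
assert (HMb : b * M = Rabs (y - f 0)) by (unfold M; field; lra).
assert (Hu : y <= f M).
{ destruct (MVT_all _ _ H1 0 M) as [c [_ Hcc]].
  assert (b * M <= Derive f c * M) by (apply Rmult_le_compat_r; [easy|apply H2]).
  generalize (Rle_abs (y - f 0)); lra. }
assert (Hl : f (- M) <= y).
{ destruct (MVT_all _ _ H1 0 (- M)) as [c [_ Hcc]].
  assert (b * M <= Derive f c * M) by (apply Rmult_le_compat_r; [easy|apply H2]).
  generalize (Rle_abs (- (y - f 0))); rewrite Rabs_Ropp; lra. }
destruct (IVT_cor (fun x => f x - y) (- M) M) as [x [_ Hx]].
- intros x; apply continuity_pt_minus; [apply Hc|apply continuity_pt_const].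
  now intros ? ?.
- lra.
- nra.
- exists x; lra.
Qed.

(** By the mean value theorem the difference quotient of the inverse [g] at y is [/ Derive f c] for
    some c between [g y] and [g (y + h)]. The lower slope bound makes [g] Lipschitz with constant
    [/ b], so c tends to [g y] and continuity of f' gives the derivative. *)
Lemma BL_plus_inverse f : BL_plus f ->
  exists g, BL_plus g /\ (forall y, f (g y) = y) /\ (forall x, g (f x) = x) /\
    (forall y, is_derive g y (/ Derive f (g y))).
Proof.
intros Hf; destruct (functional_choice _ (BL_plus_surjective f Hf)) as [g Hg].
exists g; destruct (BL_plus_elim f Hf) as [b [B [Hb [H1 [H2 H3]]]]].
assert (Hgf : forall x, g (f x) = x).
{ intros x; destruct (total_order_T (g (f x)) x) as [[H|H]|H]; [|easy|];
    apply (BL_plus_increasing f Hf) in H; rewrite Hg in H; lra. }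
assert (Hlip : forall y h, Rabs (g (y + h) - g y) <= Rabs h / b).
{ intros y h; destruct (MVT_all _ _ H1 (g y) (g (y + h))) as [c [_ Hc]].
  rewrite !Hg in Hc; replace h with (Derive f c * (g (y + h) - g y)) at 2 by lra.
  rewrite Rabs_mult, (Rabs_pos_eq (Derive f c)) by (generalize (H3 c); lra).
  apply Rmult_le_reg_r with b; [easy|].
  replace (Derive f c * Rabs (g (y + h) - g y) / b * b)
    with (Rabs (g (y + h) - g y) * Derive f c) by (field; lra).
  apply Rmult_le_compat_l; [apply Rabs_pos|apply H3]. }
assert (HD : forall y, is_derive g y (/ Derive f (g y))).
{ intros y; apply is_derive_Reals; intros eps Heps.
  assert (Hc : continuous (fun x => / Derive f x) (g y)).
  { apply continuous_comp; [apply H2|]. apply continuous_Rinv.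
    generalize (H3 (g y)); lra. }
  destruct (proj1 (filterlim_locally _ _) Hc (mkposreal _ Heps)) as [d Hd].
  (* The Lipschitz bound [Hlip] turns an increment smaller than [d * b] into a displacement of [g]
     smaller than [d]. *)
  assert (Hdb : 0 < d * b) by (apply Rmult_lt_0_compat; [apply cond_pos|easy]).
  exists (mkposreal _ Hdb); intros h Hh Hhd; simpl in Hhd.
  destruct (MVT_all _ _ H1 (g y) (g (y + h))) as [c [Hcb Hcc]].
  rewrite !Hg in Hcc.
  assert (Hfc : 0 < Derive f c) by (generalize (H3 c); lra).
  replace ((g (y + h) - g y) / h) with (/ Derive f c).
  - apply (Hd c).
    apply Rle_lt_trans with (Rabs (g (y + h) - g y)).
    + change (Rabs (c - g y) <= Rabs (g (y + h) - g y)).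
      revert Hcb; unfold Rmin, Rmax; destruct (Rle_dec (g y) (g (y + h)));
        intros Hcb; unfold Rabs;
        destruct (Rcase_abs (c - g y)), (Rcase_abs (g (y + h) - g y)); lra.
    + apply Rle_lt_trans with (1 := Hlip y h).
      apply Rmult_lt_reg_r with b; [easy|].
      replace (Rabs h / b * b) with (Rabs h) by (field; lra); easy.
  - apply Rmult_eq_reg_l with (Derive f c * h).
    + replace (Derive f c * h * / Derive f c) with h by (field; lra).
      replace (Derive f c * h * ((g (y + h) - g y) / h))
        with (Derive f c * (g (y + h) - g y)) by (field; lra).
      lra.
    + apply Rmult_integral_contrapositive; lra. }
split; [|now split].
assert (HB : 0 < B) by (generalize (H3 0); lra).
apply (BL_plus_intro (/ B) (/ b) _ (fun y => / Derive f (g y)));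
  [now apply Rinv_0_lt_compat|].
split; [easy|split].
- intros y; apply (continuous_comp g (fun x => / Derive f x)).
  + apply is_derive_continuous with (1 := HD y).
  + apply continuous_comp; [apply H2|]. apply continuous_Rinv.
    generalize (H3 (g y)); lra.
- intros y; generalize (H3 (g y)); intros; split; apply Rinv_le_contravar; lra.
Qed.

Lemma cvg_BL_plus_intro (fn fn' : nat -> R -> R) (f f' : R -> R) b B :
  0 < b -> (forall n, BL_with b B (fn n) (fn' n)) -> BL_with b B f f' ->
  (forall M eps, 0 < eps -> exists N, forall n, (N <= n)%nat ->
     forall x, Rabs x <= M -> Rabs (fn n x - f x) < eps /\ Rabs (fn' n x - f' x) < eps) ->
  cvg_BL_plus fn f.
Proof.
intros Hb Hn Hf H.
assert (HD : forall n, Derive (fn n) = fn' n) by (intros; eapply BL_with_Derive; easy).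
split; [intros n; eapply BL_plus_intro; [|apply Hn]; easy|].
split; [eapply BL_plus_intro; [|apply Hf]; easy|].
split; [|split].
- intros K HK eps Heps; destruct (compact_bounded K HK) as [M HM].
  destruct (H M eps Heps) as [N HN]; exists N; intros n Hle x Hx.
  apply (HN n Hle x), HM, Hx.
- rewrite (BL_with_Derive _ _ _ _ Hf).
  intros K HK eps Heps; destruct (compact_bounded K HK) as [M HM].
  destruct (H M eps Heps) as [N HN]; exists N; intros n Hle x Hx.
  rewrite HD; apply (HN n Hle x), HM, Hx.
- exists b, B; split; [easy|split].
  + generalize (proj2 (proj2 Hf) 0); lra.
  + intros n x; rewrite HD; apply Hn.
Qed.

Lemma is_lim_seq_C_components (u : nat -> C) (l : C) :
  filterlim u eventually (locally l) ->
  is_lim_seq (fun n => Re (u n)) (Re l) /\ is_lim_seq (fun n => Im (u n)) (Im l).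
Proof.
intros H; split.
- apply (filterlim_comp _ _ _ u fst _ (locally l)); [easy|].
  destruct l; apply continuous_fst.
- apply (filterlim_comp _ _ _ u snd _ (locally l)); [easy|].
  destruct l; apply continuous_snd.
Qed.

(** * Truncation at scale n + 1 with uniform control of slopes *)

Definition cut (n : nat) (h : R -> R) (x : R) : R :=
  plateau (/ (INR n + 1) * x) * h x.

Lemma INR_succ_pos n : 0 < INR n + 1.
Proof. generalize (pos_INR n); lra. Qed.

Lemma Rabs_div_succ n x : Rabs (/ (INR n + 1) * x) = Rabs x / (INR n + 1).
Proof.
assert (H := INR_succ_pos n).
rewrite Rabs_mult, Rabs_pos_eq by (left; now apply Rinv_0_lt_compat).
unfold Rdiv; ring.
Qed.

Lemma cut_inner n h x : Rabs x <= INR n + 1 -> cut n h x = h x.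
Proof.
intros Hx; assert (H := INR_succ_pos n).
unfold cut; rewrite plateau_eq1; [ring|].
rewrite Rabs_div_succ; apply Rmult_le_reg_r with (INR n + 1); [easy|].
unfold Rdiv; rewrite Rmult_assoc, Rinv_l; lra.
Qed.

Lemma plateau_outer n x : 2 * (INR n + 1) <= Rabs x -> plateau (/ (INR n + 1) * x) = 0.
Proof.
intros Hx; assert (H := INR_succ_pos n).
apply plateau_eq0; rewrite Rabs_div_succ.
apply Rmult_le_reg_r with (INR n + 1); [easy|].
unfold Rdiv; rewrite Rmult_assoc, Rinv_l; lra.
Qed.

Lemma smooth_dilated_plateau n : smooth (fun x => plateau (/ (INR n + 1) * x)).
Proof.
apply (smooth_comp plateau); [apply smooth_plateau|].
apply smooth_mult; [apply smooth_const|apply smooth_id].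
Qed.

Lemma Cc_infty_cut n h : smooth h -> Cc_infty (cut n h).
Proof.
intros Hh; apply Cc_infty_iff; split.
- apply smooth_mult; [apply smooth_dilated_plateau|easy].
- exists (2 * (INR n + 1)); intros x Hx; unfold cut.
  rewrite plateau_outer by lra; ring.
Qed.

Lemma is_derive_cut n h x : smooth h ->
  is_derive (cut n h) x
    (/ (INR n + 1) * Derive plateau (/ (INR n + 1) * x) * h x
     + plateau (/ (INR n + 1) * x) * Derive h x).
Proof.
intros Hh; apply (is_derive_mult (fun x => plateau (/ (INR n + 1) * x)) h).
- apply (is_derive_comp plateau (fun x => / (INR n + 1) * x)).
  + now apply smooth_is_derive, smooth_plateau.
  + auto_derive; [easy|ring].
- now apply smooth_is_derive.
- intros; apply Rmult_comm.
Qed.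

(** The dilated bump has slope at most [K / (n + 1)] and vanishes beyond [2 (n + 1)], while on its
    support [h] is at most [3 e (n + 1)]: one share from [h 0], two from the slope bound. The scale
    cancels in the product, which leaves [3 K e], plus [e] from the slope of [h] itself. *)
Lemma Derive_cut_bound K n h e :
  (forall x, Rabs (Derive plateau x) <= K) -> smooth h ->
  (forall x, Rabs (Derive h x) <= e) -> Rabs (h 0) <= e * (INR n + 1) ->
  forall x, Rabs (Derive (cut n h) x) <= e * (1 + 3 * K).
Proof.
intros HK Hh He H0 x; set (N := INR n + 1).
assert (HN : 0 < N) by apply INR_succ_pos; fold N in H0.
assert (He0 : 0 <= e) by (apply Rle_trans with (2 := He 0), Rabs_pos).
rewrite (is_derive_unique _ _ _ (is_derive_cut n h x Hh)); fold N.
apply Rle_trans with (1 := Rabs_triang _ _).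
assert (H1 : Rabs (plateau (/ N * x) * Derive h x) <= 1 * e).
{ rewrite Rabs_mult; apply Rmult_le_compat; try apply Rabs_pos; [|apply He].
  rewrite Rabs_pos_eq; apply plateau_bounds. }
assert (HK0 : 0 <= K) by (apply Rle_trans with (2 := HK 0), Rabs_pos).
assert (H2 : Rabs (/ N * Derive plateau (/ N * x) * h x) <= e * (3 * K)).
{ destruct (Rlt_dec (2 * N) (Rabs x)) as [Hx|Hx].
  - rewrite (Derive_support plateau 2).
    + rewrite Rmult_0_r, Rmult_0_l, Rabs_R0.
      apply Rmult_le_pos; lra.
    + intros y Hy; apply plateau_eq0; lra.
    + unfold N; rewrite Rabs_div_succ; fold N.
      apply Rmult_lt_reg_r with N; [easy|].
      unfold Rdiv; rewrite Rmult_assoc, Rinv_l; lra.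
  - assert (Hhx : Rabs (h x) <= e * (3 * N)).
    { assert (H := lipschitz_of_derive_bound h _ e (smooth_is_derive h Hh) He 0 x).
      rewrite Rminus_0_r in H.
      assert (e * Rabs x <= e * (2 * N)) by (apply Rmult_le_compat_l; lra).
      assert (H3 := Rabs_triang (h x - h 0) (h 0)).
      replace (h x - h 0 + h 0) with (h x) in H3 by ring; lra. }
    rewrite !Rabs_mult, (Rabs_pos_eq (/ N)) by (left; now apply Rinv_0_lt_compat).
    apply Rle_trans with (/ N * K * (e * (3 * N))).
    + assert (0 < / N) by now apply Rinv_0_lt_compat.
      apply Rmult_le_compat; [|apply Rabs_pos| |easy].
      * apply Rmult_le_pos; [lra|apply Rabs_pos].
      * apply Rmult_le_compat_l; [lra|apply HK].
    + right; field; lra. }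
lra.
Qed.

(** On each compact set the truncations eventually coincide with [h], so the substance is the slope
    bound uniform in n. The shift by [N0] makes the requirement on [h 0] hold from the first term
    on. *)
Lemma cvg_BL_plus_cut K N0 h e :
  (forall x, Rabs (Derive plateau x) <= K) -> smooth h ->
  (forall x, Rabs (Derive h x) <= e) -> Rabs (h 0) <= e * (INR N0 + 1) ->
  e * (1 + 3 * K) < 1 ->
  cvg_BL_plus (fun n x => x + cut (N0 + n) h x) (fun x => x + h x).
Proof.
intros HK Hh He H0 Hlt; set (c := e * (1 + 3 * K)) in Hlt.
assert (He0 : 0 <= e) by (apply Rle_trans with (2 := He 0), Rabs_pos).
assert (HK0 : 0 <= K) by (apply Rle_trans with (2 := HK 0), Rabs_pos).
assert (Hec : e <= c).
{ unfold c; assert (0 <= e * K) by now apply Rmult_le_pos. lra. }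
assert (HBL : forall g, smooth g -> (forall x, Rabs (Derive g x) <= c) ->
          BL_with (1 - c) (1 + c) (fun x => x + g x) (fun x => 1 + Derive g x)).
{ intros g Hg Hb; split; [|split].
  - intros x; apply (is_derive_plus (fun x : R => x) g x 1);
      [apply @is_derive_id|now apply smooth_is_derive].
  - intros x; apply (continuous_plus (fun _ : R => 1) (Derive g));
      [apply continuous_const|now apply smooth_continuous, smooth_Derive].
  - intros x; generalize (proj1 (Rabs_le_between _ _) (Hb x)); lra. }
assert (Hsc : forall n, smooth (cut n h)) by (intros n; now apply Cc_infty_iff, Cc_infty_cut).
apply (cvg_BL_plus_intro _ (fun n x => 1 + Derive (cut (N0 + n) h) x) _
  (fun x => 1 + Derive h x) (1 - c) (1 + c)); [lra| | |].
- intros n; apply HBL; [easy|].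
  apply Derive_cut_bound; try easy.
  apply Rle_trans with (1 := H0), Rmult_le_compat_l; [easy|].
  rewrite plus_INR; generalize (pos_INR n); lra.
- apply HBL; [easy|]; intros x; apply Rle_trans with (1 := He x), Hec.
- intros M eps Heps; destruct (nfloor_ex (Rabs M)) as [N [_ HN]]; [apply Rabs_pos|].
  exists N; intros n Hn x Hx.
  assert (HxM : Rabs x < INR (N0 + n) + 1).
  { assert (H1 := Rle_abs M); rewrite plus_INR.
    apply le_INR in Hn; generalize (pos_INR N0); lra. }
  split.
  + rewrite cut_inner by lra.
    replace (x + h x - (x + h x)) with 0 by ring; now rewrite Rabs_R0.
  + rewrite (Derive_ext_loc (cut (N0 + n) h) h).
    * replace (1 + Derive h x - (1 + Derive h x)) with 0 by ring; now rewrite Rabs_R0.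
    * apply filter_imp with (fun y => Rabs y < INR (N0 + n) + 1).
      -- intros y Hy; apply cut_inner; lra.
      -- apply (open_comp Rabs (fun y => y < INR (N0 + n) + 1)); [|apply open_lt|easy].
         intros y _; apply continuous_Rabs.
Qed.

(** * The kernel of the functional *)

Lemma C_eq_components (z w : C) : Re z = Re w -> Im z = Im w -> z = w.
Proof. destruct z, w; simpl; now intros -> ->. Qed.

(** The first divided difference of f at r and s, in its confluent form when the nodes coincide. It
    allows the cases alpha > 0 and alpha = 0 to be treated together. *)
Definition slope (r s : R) (f : R -> R) : R :=
  if Req_EM_T r s then Derive f r else (f r - f s) / (r - s).

(** Since [g r = 0], the quotient of g by x - r takes the value [slope r s g] at s, in the confluent
    case too. It therefore vanishes at s and can be divided once more. *)
Lemma double_division (g : R -> R) r s :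
  smooth g -> g r = 0 -> slope r s g = 0 ->
  exists h, smooth h /\ forall x, g x = (x - r) * (x - s) * h x.
Proof.
intros Sg Hr Hs; destruct (smooth_division g r Sg Hr) as [h1 [Sh1 [Hh1 HD1]]].
assert (Hs0 : h1 s = 0).
{ revert Hs; unfold slope; destruct (Req_EM_T r s) as [<-|Hrs].
  - now intros <-.
  - rewrite Hr, (Hh1 s); intros H.
    replace ((0 - (s - r) * h1 s) / (r - s)) with (h1 s) in H by (field; lra); easy. }
destruct (smooth_division h1 s Sh1 Hs0) as [h [Sh [Hh _]]].
exists h; split; [easy|]; intros x; rewrite Hh1, Hh; ring.
Qed.

Lemma is_lim_seq_eventually_const (u : nat -> R) (N : nat) (c l : R) :
  (forall n, (N <= n)%nat -> u n = c) -> is_lim_seq u l -> c = l.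
Proof.
intros H Hu; assert (Hc : is_lim_seq u c).
{ apply is_lim_seq_ext_loc with (fun _ => c); [|apply is_lim_seq_const].
  exists N; intros n Hn; now rewrite H. }
apply is_lim_seq_unique in Hu; apply is_lim_seq_unique in Hc.
rewrite Hu in Hc; now injection Hc.
Qed.

Section LinearizedAtPoint.

Variables (E : (R -> R) -> C -> C) (z0 : C) (eps0 : R) (L : (R -> R) -> C).
Hypothesis HE : admissible_extension E.
Hypothesis Hz0 : UH z0.
Hypothesis Heps0 : 0 < eps0 < 1.
Hypothesis HL : linear_functional L.
Hypothesis Hlin : forall phi : R -> R, B_infty eps0 phi ->
  E (fun x => x + phi x) z0 = (z0 + L phi)%C.

Lemma L_plus_Re f g : Cc_infty f -> Cc_infty g ->
  Re (L (fun x => f x + g x)) = Re (L f) + Re (L g).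
Proof. intros Hf Hg; now rewrite (proj1 HL f g Hf Hg). Qed.

Lemma L_plus_Im f g : Cc_infty f -> Cc_infty g ->
  Im (L (fun x => f x + g x)) = Im (L f) + Im (L g).
Proof. intros Hf Hg; now rewrite (proj1 HL f g Hf Hg). Qed.

Lemma L_scal_Re c f : Cc_infty f -> Re (L (fun x => c * f x)) = c * Re (L f).
Proof. intros Hf; rewrite (proj2 HL c f Hf); unfold Re, Im; simpl; ring. Qed.

Lemma L_scal_Im c f : Cc_infty f -> Im (L (fun x => c * f x)) = c * Im (L f).
Proof. intros Hf; rewrite (proj2 HL c f Hf); unfold Re, Im; simpl; ring. Qed.

(* Id + psi fixes [z0], so precomposing with it does not change values at [z0]. *)
Lemma kernel_invariance phi psi :
  Cc_infty phi -> Cc_infty psi ->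
  (forall x, Rabs (Derive phi x) <= eps0 / 4) ->
  (forall x, Rabs (Derive psi x) <= eps0 / 4) ->
  L psi = 0%C -> L (fun x => phi (x + psi x)) = L phi.
Proof.
intros Hphi Hpsi Bphi Bpsi H0.
destruct (proj1 (Cc_infty_iff phi) Hphi) as [Sphi [M1 HM1]].
destruct (proj1 (Cc_infty_iff psi) Hpsi) as [Spsi [M2 HM2]].
assert (Bp : BL_plus (fun x => x + phi x)).
{ apply BL_plus_perturbation with (eps0 / 4); try easy; [| |lra].
  - now apply smooth_is_derive.
  - now apply smooth_continuous, smooth_Derive. }
assert (Bq : BL_plus (fun x => x + psi x)).
{ apply BL_plus_perturbation with (eps0 / 4); try easy; [| |lra].
  - now apply smooth_is_derive.
  - now apply smooth_continuous, smooth_Derive. }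
assert (Hc : Cc_infty (fun x => phi (x + psi x))).
{ apply Cc_infty_iff; split.
  - apply (smooth_comp phi); [easy|]; apply smooth_plus; [apply smooth_id|easy].
  - exists (Rmax M1 M2); intros x Hx.
    assert (H3 := Rmax_l M1 M2); assert (H4 := Rmax_r M1 M2).
    rewrite HM2, Rplus_0_r by lra; apply HM1; lra. }
destruct HE as [_ [_ [_ [HM _]]]].
assert (Hcomp := HM _ _ Bp Bq z0 Hz0); simpl in Hcomp.
rewrite (Hlin psi), H0, Cplus_0_r, (Hlin phi) in Hcomp;
  try (apply B_infty_intro with (eps0 / 4); [easy|easy|lra]).
replace (fun x => x + psi x + phi (x + psi x))
  with (fun x => x + (psi x + phi (x + psi x))) in Hcomp
  by (apply functional_extensionality; intros; ring).
rewrite (Hlin (fun x => psi x + phi (x + psi x))) in Hcomp.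
- rewrite (proj1 HL), H0, Cplus_0_l in Hcomp by easy.
  apply (f_equal (fun w => w - z0)%C) in Hcomp.
  replace (L phi) with (z0 + L phi - z0)%C by ring.
  rewrite <- Hcomp; ring.
(* The composite perturbation has slope [psi' + (1 + psi') phi'], at most [eps0 / 4 + 2 (eps0 / 4)],
   so it stays where [E] is linear. *)
- apply B_infty_intro with (eps0 * (3 / 4)); [now apply Cc_infty_plus| |lra].
  intros x.
  assert (HD : is_derive (fun x => psi x + phi (x + psi x)) x
    (Derive psi x + (1 + Derive psi x) * Derive phi (x + psi x))).
  { apply (is_derive_plus psi (fun x => phi (x + psi x))).
    - now apply smooth_is_derive.
    - apply (is_derive_comp phi (fun x => x + psi x)).
      + now apply smooth_is_derive.
      + apply (is_derive_plus (fun x : R => x) psi x 1);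
          [apply @is_derive_id|now apply smooth_is_derive]. }
  replace (Derive (fun x => psi x + phi (x + psi x)) x)
    with (Derive psi x + (1 + Derive psi x) * Derive phi (x + psi x))
    by (symmetry; exact (is_derive_unique _ _ _ HD)).
  apply Rle_trans with (1 := Rabs_triang _ _); rewrite Rabs_mult.
  assert (H1 := Rabs_triang 1 (Derive psi x)); rewrite Rabs_R1 in H1.
  assert (H2 : Rabs (1 + Derive psi x) * Rabs (Derive phi (x + psi x)) <= 2 * (eps0 / 4)).
  { apply Rmult_le_compat; try apply Rabs_pos; [|apply Bphi].
    specialize (Bpsi x); lra. }
  specialize (Bpsi x); lra.
Qed.

Lemma kernel_scal c psi : Cc_infty psi -> L psi = 0%C -> L (fun x => c * psi x) = 0%C.
Proof. intros H1 H2; rewrite (proj2 HL), H2 by easy; ring. Qed.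

Lemma kernel_plus f g : Cc_infty f -> Cc_infty g -> L f = 0%C -> L g = 0%C ->
  L (fun x => f x + g x) = 0%C.
Proof. intros H1 H2 H3 H4; rewrite (proj1 HL), H3, H4 by easy; ring. Qed.

(* With phi = c x^2 near the support of psi, phi o (Id + s psi) is the polynomial
   phi + 2 c s x psi + c s^2 psi^2; its odd part in s must be killed by [L]. *)
Lemma kernel_mult_id psi : Cc_infty psi -> L psi = 0%C -> L (fun x => x * psi x) = 0%C.
Proof.
intros Hpsi H0.
destruct (Cc_infty_bounded psi Hpsi) as [K [HK HKb]].
destruct (proj1 (Cc_infty_iff psi) Hpsi) as [Spsi [M HM]].
destruct (nfloor_ex (Rabs M)) as [N [_ HN]]; [apply Rabs_pos|].
(* [S N] rather than [N]: for |x| <= M the shifted point [x + s * psi x] may leave [-M, M], but by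
   at most 1, and the square must still be untruncated there. *)
set (phi0 := cut (S N) (fun x => x * x)).
assert (Hphi0 : Cc_infty phi0).
{ apply Cc_infty_cut, smooth_mult; apply smooth_id. }
destruct (Cc_infty_bounded phi0 Hphi0) as [K0 [HK0 HKb0]].
(* These scale the slopes of [phi0] and [psi] down to the bound [eps0 / 4] of
   [kernel_invariance]. *)
set (c := eps0 / (4 * K0)); set (t := eps0 / (4 * K)).
assert (Hc : 0 < c) by (apply Rdiv_lt_0_compat; lra).
assert (Ht : 0 < t) by (apply Rdiv_lt_0_compat; lra).
assert (Hxpsi : Cc_infty (fun x => x * psi x)).
{ apply (Cc_infty_mult (fun x => x)); [apply smooth_id|easy]. }
assert (Hpsi2 : Cc_infty (fun x => psi x * psi x)) by now apply Cc_infty_mult.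
assert (HcK : c * K0 = eps0 / 4) by (unfold c; field; lra).
assert (HtK : t * K = eps0 / 4) by (unfold t; field; lra).
assert (key : forall s, Rabs s = t ->
  ((RtoC (2 * c * s) * L (fun x => (x * psi x)%R))
   + (RtoC (c * (s * s)) * L (fun x => (psi x * psi x)%R)) = 0)%C).
{ intros s Hs.
  assert (Hinv := kernel_invariance (fun x => c * phi0 x) (fun x => s * psi x)).
  simpl in Hinv.
  replace (fun x => c * phi0 (x + s * psi x)) with
    (fun x => c * phi0 x + (2 * c * s * (x * psi x) + c * (s * s) * (psi x * psi x)))
    in Hinv.
  - rewrite (proj1 HL (fun x => c * phi0 x)) in Hinv;
      [|now apply Cc_infty_scal|apply Cc_infty_plus; now apply Cc_infty_scal].
    rewrite (proj1 HL (fun x => 2 * c * s * (x * psi x))) in Hinv;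
      [|now apply Cc_infty_scal|now apply Cc_infty_scal].
    rewrite (proj2 HL (2 * c * s)), (proj2 HL (c * (s * s))) in Hinv by easy.
    rewrite (proj2 HL c) in Hinv by easy.
    apply (f_equal (fun w => w - RtoC c * L phi0)%C) in Hinv.
    + rewrite Cplus_comm in Hinv; unfold Cminus in Hinv at 1.
      rewrite <- Cplus_assoc, Cplus_opp_r, Cplus_0_r in Hinv.
      rewrite Hinv; ring.
    + now apply Cc_infty_scal.
    + now apply Cc_infty_scal.
    + intros x; rewrite Derive_scal, Rabs_mult, (Rabs_pos_eq c) by lra.
      rewrite <- HcK; apply Rmult_le_compat_l; [lra|apply HKb0].
    + intros x; rewrite Derive_scal, Rabs_mult, Hs.
      rewrite <- HtK; apply Rmult_le_compat_l; [lra|apply HKb].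
    + now apply kernel_scal.
  - apply functional_extensionality; intros x.
    destruct (Rlt_dec M (Rabs x)) as [Hx|Hx].
    + rewrite HM by easy; replace (x + s * 0) with x by ring; ring.
    + assert (Hle := Rle_abs M).
      assert (Hspsi : Rabs (s * psi x) <= 1).
      { rewrite Rabs_mult, Hs.
        assert (t * Rabs (psi x) <= t * K) by (apply Rmult_le_compat_l; [lra|apply HKb]).
        lra. }
      assert (Htr := Rabs_triang x (s * psi x)).
      unfold phi0; rewrite !cut_inner by (rewrite S_INR; lra); ring. }
assert (k1 := key t (Rabs_pos_eq _ (Rlt_le _ _ Ht))).
assert (k2 := key (- t) (eq_trans (Rabs_Ropp t) (Rabs_pos_eq _ (Rlt_le _ _ Ht)))).
assert (Hct : 0 < 4 * c * t) by (assert (0 < c * t) by (now apply Rmult_lt_0_compat); lra).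
set (A := L (fun x => x * psi x)) in *; set (B := L (fun x => psi x * psi x)) in *.
assert (H : (RtoC (4 * c * t) * A = 0)%C).
{ apply (f_equal Copp) in k2; assert (k := f_equal2 Cplus k1 k2).
  transitivity (RtoC (2 * c * t) * A + RtoC (c * (t * t)) * B +
     - (RtoC (2 * c * - t) * A + RtoC (c * (- t * - t)) * B))%C.
  - apply C_eq_components; simpl; ring.
  - rewrite k; apply C_eq_components; simpl; ring. }
apply (f_equal (fun w => RtoC (/ (4 * c * t)) * w)%C) in H.
replace A with (RtoC (/ (4 * c * t)) * (RtoC (4 * c * t) * A))%C.
- rewrite H; ring.
- rewrite Cmult_assoc, <- RtoC_mult, Rinv_l by lra; ring.
Qed.

(** * The functional on truncated affine functions *)

Lemma E_linear phi : B_infty eps0 phi ->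
  Re (E (fun x => x + phi x) z0) = Re z0 + Re (L phi) /\
  Im (E (fun x => x + phi x) z0) = Im z0 + Im (L phi).
Proof. intros H; now rewrite (Hlin phi H). Qed.

Lemma E_sequential_limit fn f : cvg_BL_plus fn f ->
  is_lim_seq (fun n => Re (E (fn n) z0)) (Re (E f z0)) /\
  is_lim_seq (fun n => Im (E (fn n) z0)) (Im (E f z0)).
Proof.
intros H; destruct HE as [_ [_ [_ [_ H4]]]].
apply (is_lim_seq_C_components (fun n => E (fn n) z0)), (H4 _ _ H z0 Hz0).
Qed.

(** With [h = k x + m], the maps Id + e cut(h) converge to the affine map Id + e h, whose extension
    sends [z0] to [z0 + e (k z0 + m)]. For small [e] the values along the sequence are
    [z0 + e L(cut h)]; subtracting [z0] and dividing by [e] gives the limit. *)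
Lemma L_cut_limit k m : Rabs k <= 1 -> Rabs m <= 1 ->
  is_lim_seq (fun n => Re (L (cut n (fun x => k * x + m)))) (k * Re z0 + m) /\
  is_lim_seq (fun n => Im (L (cut n (fun x => k * x + m)))) (k * Im z0).
Proof.
intros Hk Hm; set (h := fun x => k * x + m).
destruct plateau_slope_bound as [K [HK HKb]].
set (e := eps0 / (2 * (1 + 3 * K))).
assert (He : 0 < e) by (apply Rdiv_lt_0_compat; lra).
assert (HeK : e * (1 + 3 * K) = eps0 / 2) by (unfold e; field; lra).
assert (He1 : e < 1) by (assert (0 < e * (3 * K)) by (apply Rmult_lt_0_compat; lra); lra).
assert (Sh : smooth h).
{ apply smooth_plus; [|apply smooth_const].
  apply smooth_mult; [apply smooth_const|apply smooth_id]. }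
assert (Seh : smooth (fun x => e * h x)).
{ apply smooth_mult; [apply smooth_const|easy]. }
assert (HD : forall x, Rabs (Derive (fun x => e * h x) x) <= e).
{ intros x; replace (Derive (fun x => e * h x) x) with (e * k).
  - rewrite Rabs_mult, (Rabs_pos_eq e) by lra.
    rewrite <- (Rmult_1_r e) at 2; apply Rmult_le_compat_l; lra.
  - symmetry; apply is_derive_unique; unfold h; auto_derive; [easy|ring]. }
assert (H0 : Rabs (e * h 0) <= e * (INR 0 + 1)).
{ unfold h; rewrite Rmult_0_r, Rplus_0_l, Rabs_mult, (Rabs_pos_eq e) by lra.
  simpl; apply Rmult_le_compat_l; lra. }
assert (Hcvg := cvg_BL_plus_cut K 0 _ e HKb Seh HD H0 ltac:(lra)).
destruct (E_sequential_limit _ _ Hcvg) as [HRe HIm]; simpl in HRe, HIm; clear Hcvg.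
replace (fun x => x + e * h x) with (fun x => (1 + e * k) * x + e * m) in HRe, HIm
  by (apply functional_extensionality; intros x; unfold h; ring).
assert (Hek : Rabs (e * k) < 1).
{ rewrite Rabs_mult, (Rabs_pos_eq e) by lra.
  assert (e * Rabs k <= e * 1) by (apply Rmult_le_compat_l; lra); lra. }
destruct HE as [_ [_ [Haff _]]].
rewrite Haff in HRe, HIm; [|apply Rabs_lt_between in Hek; lra|easy
  |apply Rabs_lt_between in Hek; lra|easy].
assert (HB : forall n, B_infty eps0 (cut n (fun x => e * h x))).
{ intros n; apply B_infty_intro with (eps0 / 2); [now apply Cc_infty_cut| |lra].
  rewrite <- HeK; apply Derive_cut_bound; try easy.
  apply Rle_trans with (1 := H0), Rmult_le_compat_l; [lra|].
  simpl; generalize (pos_INR n); lra. }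
assert (Hsc : forall n, cut n (fun x => e * h x) = (fun x => e * cut n h x)).
{ intros n; apply functional_extensionality; intros x; unfold cut; ring. }
assert (Hcc : forall n, Cc_infty (cut n h)) by (intros; now apply Cc_infty_cut).
split.
- apply is_lim_seq_ext with
    (fun n => / e * (Re (E (fun x => x + cut n (fun x => e * h x) x) z0) - Re z0)).
  + intros n; rewrite (proj1 (E_linear _ (HB n))), Hsc, L_scal_Re by easy.
    field; lra.
  + replace (Finite (k * Re z0 + m)) with
      (Rbar_mult (/ e) (Re ((1 + e * k)%R * z0 + (e * m)%R)%C - Re z0)).
    * apply is_lim_seq_scal_l, is_lim_seq_minus'; [exact HRe|apply is_lim_seq_const].
    * simpl; f_equal; unfold Re; field; lra.
- apply is_lim_seq_ext with
    (fun n => / e * (Im (E (fun x => x + cut n (fun x => e * h x) x) z0) - Im z0)).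
  + intros n; rewrite (proj2 (E_linear _ (HB n))), Hsc, L_scal_Im by easy.
    field; lra.
  + replace (Finite (k * Im z0)) with
      (Rbar_mult (/ e) (Im ((1 + e * k)%R * z0 + (e * m)%R)%C - Im z0)).
    * apply is_lim_seq_scal_l, is_lim_seq_minus'; [exact HIm|apply is_lim_seq_const].
    * simpl; f_equal; unfold Im; field; lra.
Qed.

Lemma L_cut_const_limit :
  is_lim_seq (fun n => Re (L (cut n (fun _ => 1)))) 1 /\
  is_lim_seq (fun n => Im (L (cut n (fun _ => 1)))) 0.
Proof.
assert (H := L_cut_limit 0 1 ltac:(rewrite Rabs_R0; lra) ltac:(rewrite Rabs_R1; lra)).
replace (fun x => 0 * x + 1) with (fun _ : R => 1) in H
  by (apply functional_extensionality; intros; ring).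
now rewrite !Rmult_0_l, Rplus_0_l in H.
Qed.

Lemma L_cut_id_limit :
  is_lim_seq (fun n => Re (L (cut n (fun x => x)))) (Re z0) /\
  is_lim_seq (fun n => Im (L (cut n (fun x => x)))) (Im z0).
Proof.
assert (H := L_cut_limit 1 0 ltac:(rewrite Rabs_R1; lra) ltac:(rewrite Rabs_R0; lra)).
replace (fun x => 1 * x + 0) with (fun x : R => x) in H
  by (apply functional_extensionality; intros; ring).
now rewrite !Rmult_1_l, Rplus_0_r in H.
Qed.

(** * The quadratic polynomial and its roots *)

Ltac solve_Cc_infty :=
  repeat (match goal with
    | |- Cc_infty (fun x => @?f x + @?g x) => apply (Cc_infty_plus f g)
    | |- Cc_infty (fun x => ?c * @?f x) => apply (Cc_infty_scal c f)
  end; cbv beta); assumption.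

(* The images of 1 and x (cut off) are close to 1 and [z0], so they span C over R;
   multiplication by x acts on C = Cc_infty / ker L, and Cayley-Hamilton gives the
   quadratic polynomial. *)
Lemma kernel_quadratic :
  exists tau delta, forall psi, Cc_infty psi ->
    L (fun x => (x * x - tau * x + delta) * psi x) = 0%C.
Proof.
destruct L_cut_const_limit as [H1 H2], L_cut_id_limit as [H3 H4].
(* The determinant of the two values of [L] as vectors of the real plane. Its limit is [Im z0 > 0],
   so some scale n makes them a basis. *)
set (D := fun n => Re (L (cut n (fun _ => 1))) * Im (L (cut n (fun x => x)))
                 - Im (L (cut n (fun _ => 1))) * Re (L (cut n (fun x => x)))).
assert (HD : is_lim_seq D (1 * Im z0 - 0 * Re z0)).
{ apply is_lim_seq_minus'; now apply is_lim_seq_mult'. }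
assert (Hex : exists n, D n <> 0).
{ apply is_lim_seq_spec in HD.
  assert (Hp : 0 < 1 * Im z0 - 0 * Re z0) by (generalize Hz0; unfold UH; lra).
  destruct (HD (mkposreal _ Hp)) as [N HN]; exists N.
  specialize (HN N (le_n _)); simpl in HN; apply Rabs_lt_between in HN; lra. }
destruct Hex as [n Hn]; unfold D in Hn.
set (chi := cut n (fun _ => 1)) in *.
assert (Hcut : cut n (fun x => x) = (fun x => x * chi x)).
{ apply functional_extensionality; intros x; unfold chi, cut; ring. }
rewrite Hcut in Hn; clear D HD H1 H2 H3 H4 Hcut.
assert (C1 : Cc_infty chi) by apply Cc_infty_cut, smooth_const.
clearbody chi.
assert (Cx : forall f, Cc_infty f -> Cc_infty (fun x => x * f x)).
{ intros f; apply (Cc_infty_mult (fun x => x)), smooth_id. }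
assert (C2 := Cx _ C1); assert (C3 := Cx _ C2); simpl in C3.
set (a1 := Re (L chi)) in *; set (a2 := Im (L chi)) in *.
set (b1 := Re (L (fun x => x * chi x))) in *.
set (b2 := Im (L (fun x => x * chi x))) in *.
(* Cramer's rule: modulo the kernel, every f is a real combination of [chi] and [x * chi]. *)
assert (dec : forall f, Cc_infty f -> exists u v,
  L (fun x => f x + (u * chi x + v * (x * chi x))) = 0%C).
{ intros f Hf.
  exists (- ((Re (L f) * b2 - Im (L f) * b1) / (a1 * b2 - a2 * b1))),
    (- ((a1 * Im (L f) - a2 * Re (L f)) / (a1 * b2 - a2 * b1))).
  apply C_eq_components.
  - rewrite !L_plus_Re, !L_scal_Re by solve_Cc_infty; fold a1 b1.
    simpl; field; easy.
  - rewrite !L_plus_Im, !L_scal_Im by solve_Cc_infty; fold a2 b2.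
    simpl; field; easy. }
destruct (dec _ C3) as [delta [mtau Hk]].
exists (- mtau), delta; intros psi Hpsi.
destruct (dec _ Hpsi) as [u [v Hpsi0]].
set (k := fun x => x * (x * chi x) + (delta * chi x + mtau * (x * chi x))) in Hk.
set (psi0 := fun x => psi x + (u * chi x + v * (x * chi x))) in Hpsi0.
assert (Ck : Cc_infty k) by (unfold k; solve_Cc_infty).
assert (C0 : Cc_infty psi0) by (unfold psi0; solve_Cc_infty).
assert (Kx : L (fun x => x * psi0 x) = 0%C) by now apply kernel_mult_id.
assert (Kxx : L (fun x => x * (x * psi0 x)) = 0%C).
{ apply (kernel_mult_id (fun x => x * psi0 x)); [now apply Cx|easy]. }
assert (Kk : L (fun x => x * k x) = 0%C) by now apply kernel_mult_id.
assert (C0x := Cx _ C0); assert (C0xx := Cx _ C0x); assert (Ckx := Cx _ Ck); simpl in C0xx.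
(* Let q be the quadratic. Then [k = q chi] and [psi = psi0 - u chi - v x chi], whence
   [q psi = q psi0 - u k - v x k]; each term is a kernel element multiplied by a polynomial. *)
replace (fun x => (x * x - - mtau * x + delta) * psi x) with
  (fun x => x * (x * psi0 x) + (mtau * (x * psi0 x) + (delta * psi0 x
     + (- u * k x + - v * (x * k x)))))
  by (apply functional_extensionality; intros x; unfold psi0, k; ring).
clearbody k psi0.
repeat apply kernel_plus; try solve_Cc_infty; try apply kernel_scal; assumption.
Qed.

Lemma L_quotient_kernel p psi : Cc_infty psi -> smooth p ->
  (forall x, p x <> 0) -> (forall f, Cc_infty f -> L (fun x => p x * f x) = 0%C) ->
  L psi = 0%C.
Proof.
intros Hpsi Hp Hnz HK.
replace psi with (fun x => p x * (/ p x * psi x))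
  by (apply functional_extensionality; intros x; field; apply Hnz).
apply HK, (Cc_infty_mult (fun x => / p x)); [now apply smooth_inv|easy].
Qed.

Lemma L_nonzero : ~ (forall psi, Cc_infty psi -> L psi = 0%C).
Proof.
intros H; destruct L_cut_const_limit as [H1 _].
assert (H2 : is_lim_seq (fun n => Re (L (cut n (fun _ => 1)))) 0).
{ apply is_lim_seq_ext with (fun _ => 0); [|apply is_lim_seq_const].
  intros n; rewrite H; [easy|]; apply Cc_infty_cut, smooth_const. }
apply is_lim_seq_unique in H1; apply is_lim_seq_unique in H2.
rewrite H1 in H2; injection H2; lra.
Qed.

(** The larger root is named first because r - s becomes a positive multiple of alpha. *)
Lemma kernel_roots : exists r s, s <= r /\ forall psi, Cc_infty psi ->
  L (fun x => (x - r) * (x - s) * psi x) = 0%C.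
Proof.
destruct kernel_quadratic as [tau [delta H]].
set (disc := tau * tau - 4 * delta).
destruct (Rle_dec 0 disc) as [Hd|Hd].
- assert (Hs := sqrt_sqrt disc Hd); assert (Hs0 := sqrt_pos disc).
  exists ((tau + sqrt disc) / 2), ((tau - sqrt disc) / 2); split; [lra|].
  intros psi Hpsi; rewrite <- (H psi Hpsi); f_equal.
  apply functional_extensionality; intros x; f_equal.
  replace delta with ((tau * tau - sqrt disc * sqrt disc) / 4)
    by (rewrite Hs; unfold disc; field).
  field.
- exfalso; apply L_nonzero; intros psi Hpsi.
  apply (L_quotient_kernel (fun x => x * x - tau * x + delta)); try easy.
  + apply smooth_plus; [|apply smooth_const].
    apply smooth_minus; apply smooth_mult; try apply smooth_id; apply smooth_const.
  + intros x Hx; assert (0 <= (2 * x - tau) * (2 * x - tau)) by apply Rle_0_sqr.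
    unfold disc in Hd; lra.
Qed.

(* The value is the one at [z0] of the affine Hermite interpolant of psi at r and s. *)
Lemma L_interpolation : exists r s, s <= r /\ forall psi, Cc_infty psi ->
  Re (L psi) = psi r + slope r s psi * (Re z0 - r) /\
  Im (L psi) = slope r s psi * Im z0.
Proof.
destruct kernel_roots as [r [s [Hrs HK]]]; exists r, s; split; [easy|].
intros psi Hpsi; set (b := slope r s psi); set (a := psi r - b * r).
destruct (proj1 (Cc_infty_iff psi) Hpsi) as [Spsi [M HM]].
destruct (nfloor_ex (Rabs r + Rabs s)) as [N [_ HN]].
{ generalize (Rabs_pos r) (Rabs_pos s); lra. }
assert (Cc1 : forall n, Cc_infty (cut n (fun _ => 1))).
{ intros; apply Cc_infty_cut, smooth_const. }
assert (Ccx : forall n, Cc_infty (cut n (fun x => x))).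
{ intros; apply Cc_infty_cut, smooth_id. }
(* For these n both nodes lie where the truncation is inactive, so psi minus its truncated
   interpolant is divisible by (x - r)(x - s) and lies in the kernel. The left side does not depend
   on n and the right side converges, which evaluates [L psi]. *)
assert (key : forall n, (N <= n)%nat ->
  L psi = (RtoC a * L (cut n (fun _ => 1)) + RtoC b * L (cut n (fun x => x)))%C).
{ intros n Hn; apply le_INR in Hn.
  assert (Hr : Rabs r < INR n + 1) by (generalize (Rabs_pos s); lra).
  assert (Hs : Rabs s < INR n + 1) by (generalize (Rabs_pos r); lra).
  set (ell := fun x => a * cut n (fun _ => 1) x + b * cut n (fun x => x) x).
  assert (Cell : Cc_infty ell).
  { unfold ell; apply Cc_infty_plus; now apply Cc_infty_scal. }
  assert (Hell : forall x, Rabs x < INR n + 1 -> ell x = a + b * x).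
  { intros x Hx; unfold ell; rewrite !cut_inner by lra; ring. }
  set (g := fun x => psi x + (-1) * ell x).
  assert (Cg : Cc_infty g).
  { unfold g; apply Cc_infty_plus; [easy|now apply Cc_infty_scal]. }
  destruct (proj1 (Cc_infty_iff g) Cg) as [Sg [Mg HMg]].
  assert (Hgr : g r = 0) by (unfold g; rewrite Hell by easy; unfold a; ring).
  assert (Hgs : slope r s g = 0).
  { unfold slope; destruct (Req_EM_T r s) as [Heq|Hne].
    - apply is_derive_unique; replace 0 with (Derive psi r + (-1) * b).
      + apply (is_derive_plus psi (fun x => (-1) * ell x)); [now apply smooth_is_derive|].
        apply (is_derive_scal ell r (-1)).
        apply is_derive_ext_loc with (fun x => a + b * x).
        * apply filter_imp with (fun y => Rabs y < INR n + 1);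
            [intros y Hy; now rewrite Hell|].
          apply (open_comp Rabs (fun y => y < INR n + 1)); [|apply open_lt|easy].
          intros y _; apply continuous_Rabs.
        * auto_derive; [easy|ring].
      + unfold b, slope; destruct (Req_EM_T r s); [ring|easy].
    - replace (g s) with 0; [rewrite Hgr; field; lra|].
      unfold g; rewrite Hell by easy; unfold a, b, slope.
      destruct (Req_EM_T r s); [easy|]; field; lra. }
  destruct (double_division g r s Sg Hgr Hgs) as [h [Sh Hh]].
  (* Beyond the support of g and beyond both nodes the two linear factors are nonzero, so the
     quotient vanishes there. *)
  assert (Ch : Cc_infty h).
  { apply Cc_infty_iff; split; [easy|].
    exists (Rmax Mg (Rmax (Rabs r) (Rabs s))); intros x Hx.
    assert (Hm1 := Rmax_l Mg (Rmax (Rabs r) (Rabs s))).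
    assert (Hm2 := Rmax_r Mg (Rmax (Rabs r) (Rabs s))).
    assert (Hm3 := Rmax_l (Rabs r) (Rabs s)); assert (Hm4 := Rmax_r (Rabs r) (Rabs s)).
    assert (Hgx := HMg x ltac:(lra)); rewrite Hh in Hgx.
    assert (x - r <> 0) by (intros Hxr; replace x with r in Hx by lra; lra).
    assert (x - s <> 0) by (intros Hxs; replace x with s in Hx by lra; lra).
    destruct (Rmult_integral _ _ Hgx) as [Hz|]; [|easy].
    destruct (Rmult_integral _ _ Hz); lra. }
  assert (Lg : L g = 0%C).
  { replace g with (fun x => (x - r) * (x - s) * h x)
      by (apply functional_extensionality; intros x; now rewrite Hh).
    now apply HK. }
  replace psi with (fun x => g x + ell x) at 1
    by (apply functional_extensionality; intros x; unfold g; ring).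
  rewrite (proj1 HL), Lg, Cplus_0_l by easy; unfold ell.
  rewrite (proj1 HL _ _ (Cc_infty_scal a _ (Cc1 n)) (Cc_infty_scal b _ (Ccx n))).
  now rewrite (proj2 HL a _ (Cc1 n)), (proj2 HL b _ (Ccx n)). }
destruct L_cut_const_limit as [H1 H2], L_cut_id_limit as [H3 H4]; split.
- replace (psi r + b * (Re z0 - r)) with (a * 1 + b * Re z0) by (unfold a; ring).
  apply (is_lim_seq_eventually_const
    (fun n => a * Re (L (cut n (fun _ => 1))) + b * Re (L (cut n (fun x => x)))) N).
  + intros n Hn; rewrite (key n Hn); unfold Re; simpl; ring.
  + apply is_lim_seq_plus'; now apply (is_lim_seq_scal_l _ _ (Finite _)).
- replace (b * Im z0) with (a * 0 + b * Im z0) by ring.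
  apply (is_lim_seq_eventually_const
    (fun n => a * Im (L (cut n (fun _ => 1))) + b * Im (L (cut n (fun x => x)))) N).
  + intros n Hn; rewrite (key n Hn); unfold Im; simpl; ring.
  + apply is_lim_seq_plus'; now apply (is_lim_seq_scal_l _ _ (Finite _)).
Qed.

End LinearizedAtPoint.

(** * Approximation of C^1 functions *)

(** As a difference of consecutive shifts of [step], its integer translates have telescoping sums,
    hence form a partition of unity. *)
Definition hat (y : R) : R := step (y + 1) - step y.

Lemma hat_ge0 y : 0 <= hat y.
Proof.
unfold hat; assert (H1 := step_bounds y); assert (H2 := step_bounds (y + 1)).
destruct (Rle_dec y 0); [rewrite (step_left y)|rewrite (step_right (y + 1))]; lra.
Qed.

Lemma hat_support y : hat y <> 0 -> Rabs y < 1.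
Proof.
intros H; apply Rabs_lt_between; split; apply Rnot_le_lt; intros Hy; apply H; unfold hat.
- rewrite !step_left; lra.
- rewrite !step_right; lra.
Qed.

Lemma sum_hat y m : sum_f_R0 (fun j => hat (y - INR j)) m = step (y + 1) - step (y - INR m).
Proof.
induction m as [|m IH].
- simpl; unfold hat; now rewrite Rminus_0_r.
- change (sum_f_R0 (fun j => hat (y - INR j)) (S m))
    with (sum_f_R0 (fun j => hat (y - INR j)) m + hat (y - INR (S m))).
  rewrite IH; unfold hat; rewrite S_INR.
  replace (y - (INR m + 1) + 1) with (y - INR m) by ring; ring.
Qed.

Lemma smooth_hat : smooth hat.
Proof.
apply smooth_minus; [|apply smooth_step].
apply (smooth_comp step); [apply smooth_step|].
apply smooth_plus; [apply smooth_id|apply smooth_const].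
Qed.

(* Partition of unity at scale 1/(n+1) on [-(n+1), n+1]. *)
Definition hat_interpolant (u : R -> R) (n : nat) (x : R) : R :=
  let N := INR (S n) in
  sum_f_R0 (fun j => u (INR j / N - N) * hat (N * (x + N) - INR j)) (2 * (S n * S n)).

Lemma smooth_sum (F : nat -> R -> R) m :
  (forall j, smooth (F j)) -> smooth (fun x => sum_f_R0 (fun j => F j x) m).
Proof.
intros H; induction m as [|m IH]; simpl; [apply H|].
apply smooth_plus; [exact IH|apply H].
Qed.

Lemma smooth_hat_interpolant u n : smooth (hat_interpolant u n).
Proof.
apply smooth_sum; intros j; apply smooth_mult; [apply smooth_const|].
apply (smooth_comp hat); [apply smooth_hat|].
apply smooth_minus; [|apply smooth_const].
apply smooth_mult; [apply smooth_const|].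
apply smooth_plus; [apply smooth_id|apply smooth_const].
Qed.

(** The weights are nonnegative with sum at most 1, and only nodes at distance less than 1 from y
    carry weight. *)
Lemma sum_hat_weighted_bound (v : nat -> R) e y m :
  0 <= e -> (forall j, Rabs (y - INR j) < 1 -> Rabs (v j) <= e) ->
  Rabs (sum_f_R0 (fun j => v j * hat (y - INR j)) m) <= e.
Proof.
intros He Hv; apply Rle_trans with (1 := Rsum_abs _ _).
apply Rle_trans with (sum_f_R0 (fun j => hat (y - INR j) * e) m).
- apply sum_Rle; intros j _; rewrite Rabs_mult, (Rabs_pos_eq (hat _)) by apply hat_ge0.
  destruct (Req_dec (hat (y - INR j)) 0) as [->|Hne]; [lra|].
  rewrite Rmult_comm; apply Rmult_le_compat_l; [apply hat_ge0|].
  now apply Hv, hat_support.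
- rewrite <- scal_sum, sum_hat.
  rewrite <- (Rmult_1_r e) at 2; apply Rmult_le_compat_l; [easy|].
  generalize (step_bounds (y + 1)) (step_bounds (y - INR m)); lra.
Qed.

Lemma hat_interpolant_bound u e n x :
  (forall x, Rabs (u x) <= e) -> Rabs (hat_interpolant u n x) <= e.
Proof.
intros H; apply (sum_hat_weighted_bound (fun j => u (INR j / INR (S n) - INR (S n)))).
- apply Rle_trans with (2 := H 0), Rabs_pos.
- intros; apply H.
Qed.

Lemma hat_interpolant_error u n x e :
  0 <= e -> Rabs x <= INR (S n) ->
  (forall t, Rabs (t - x) < / INR (S n) -> Rabs (u t - u x) <= e) ->
  Rabs (hat_interpolant u n x - u x) <= e.
Proof.
intros He Hx Hu; unfold hat_interpolant; set (N := INR (S n)) in *.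
assert (HN : 0 < N) by apply lt_0_INR, Nat.lt_0_succ.
apply Rabs_le_between in Hx.
(* [y] measures the distance from -N in units of the mesh [/ N], so [-N, N] becomes [0, m]. On this
   range the telescoped sum [step (y + 1) - step (y - m)] is 1 - 0. *)
set (y := N * (x + N)); set (m := (2 * (S n * S n))%nat).
assert (Hm : INR m = 2 * (N * N)) by (unfold m; rewrite !mult_INR; unfold N; simpl; ring).
assert (H1 : sum_f_R0 (fun j => hat (y - INR j)) m = 1).
{ rewrite sum_hat, step_right, step_left; [ring| |].
  - rewrite Hm; unfold y; nra.
  - unfold y; nra. }
replace (sum_f_R0 (fun j => u (INR j / N - N) * hat (y - INR j)) m - u x)
  with (sum_f_R0 (fun j => (u (INR j / N - N) - u x) * hat (y - INR j)) m).
- apply (sum_hat_weighted_bound (fun j => u (INR j / N - N) - u x)); [easy|].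
  intros j Hj; apply Hu.
  replace (INR j / N - N - x) with (- (y - INR j) * / N) by (unfold y; field; lra).
  rewrite Rabs_mult, Rabs_Ropp, (Rabs_pos_eq (/ N)) by (left; now apply Rinv_0_lt_compat).
  apply Rlt_le_trans with (1 * / N); [|lra].
  apply Rmult_lt_compat_r; [now apply Rinv_0_lt_compat|easy].
- transitivity (sum_f_R0 (fun j => u (INR j / N - N) * hat (y - INR j)) m
    - u x * sum_f_R0 (fun j => hat (y - INR j)) m); [|rewrite H1; ring].
  rewrite scal_sum, <- minus_sum; apply sum_eq; intros; ring.
Qed.

(** The derivative is interpolated, then integrated from the common value at 0. Averaging preserves
    the slope bound [e] without loss, and the error of the functions on [-M, M] is at most M times
    that of the derivatives. *)
Lemma smooth_C1_approximation (phi phi' : R -> R) e :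
  (forall x, is_derive phi x (phi' x)) -> (forall x, continuous phi' x) ->
  (forall x, Rabs (phi' x) <= e) ->
  exists h : nat -> R -> R,
    (forall n, smooth (h n)) /\ (forall n x, Rabs (Derive (h n) x) <= e) /\
    forall M eps, 0 < eps -> exists N, forall n, (N <= n)%nat -> forall x, Rabs x <= M ->
      Rabs (h n x - phi x) < eps /\ Rabs (Derive (h n) x - phi' x) < eps.
Proof.
intros H1 H2 H3.
set (m := hat_interpolant phi').
set (h := fun n x => phi 0 + RInt (m n) 0 x).
assert (Hd : forall n x, is_derive (h n) x (m n x)).
{ intros n x; replace (m n x) with (0 + m n x) by ring.
  apply (is_derive_plus (fun _ : R => phi 0) (fun x => RInt (m n) 0 x));
    [apply @is_derive_const|].
  apply smooth_RInt, smooth_hat_interpolant. }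
assert (HD : forall n, Derive (h n) = m n) by (intros; now apply is_derive_Derive_eq).
exists h; split; [|split].
- intros n; apply smooth_primitive with (m n); [apply Hd|apply smooth_hat_interpolant].
- intros n x; rewrite HD; now apply hat_interpolant_bound.
- intros M0 eps Heps; set (M := Rabs M0).
  assert (HM : 0 <= M) by apply Rabs_pos.
  (* An error [e'] in the derivative gives at most [e' * M] in the function; both are then strictly
     below [eps]. *)
  set (e' := eps / (M + 2)).
  assert (He' : 0 < e') by (apply Rdiv_lt_0_compat; lra).
  assert (He'M : e' * (M + 2) = eps) by (unfold e'; field; lra).
  destruct (@Heine_cor2 phi' (- M - 1) (M + 1)
    (fun x _ => proj2 (continuity_pt_filterlim _ _) (H2 x)) (mkposreal _ He'))
    as [[d Hd0] Hdelta].
  simpl in Hdelta.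
  assert (Hi : 0 < / d) by now apply Rinv_0_lt_compat.
  (* One choice serves two ends: the grid covers [-M, M], and its mesh is below the modulus [d] of
     uniform continuity. *)
  destruct (nfloor_ex (M + / d)) as [N [_ HN]]; [lra|].
  exists N; intros n Hn.
  apply le_INR in Hn.
  assert (Herr : forall x, Rabs x <= M -> Rabs (m n x - phi' x) <= e').
  { intros x Hx; apply hat_interpolant_error; [lra|rewrite S_INR; lra|].
    intros t Ht.
    assert (Hinv1 : / INR (S n) <= 1).
    { rewrite <- Rinv_1; apply Rinv_le_contravar; [lra|].
      rewrite S_INR; generalize (pos_INR n); lra. }
    assert (Hinv2 : / INR (S n) <= d).
    { rewrite <- (Rinv_inv d); apply Rinv_le_contravar; [easy|rewrite S_INR; lra]. }
    apply Rabs_le_between in Hx; apply Rlt_le.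
    assert (Ht' := Ht); apply Rabs_lt_between in Ht'.
    apply Hdelta; lra. }
  intros x Hx; assert (HxM : Rabs x <= M) by (generalize (Rle_abs M0); fold M; lra).
  rewrite HD; split.
  + destruct (MVT_all (fun y => h n y - phi y) (fun y => m n y - phi' y)) with (x := 0) (y := x)
      as [c [Hc Heq]].
    { intros y; now apply (is_derive_minus (h n) phi). }
    assert (Hcx : Rabs c <= Rabs x).
    { revert Hc; unfold Rmin, Rmax; destruct (Rle_dec 0 x); intros Hc.
      - rewrite !Rabs_pos_eq; lra.
      - rewrite !Rabs_left1; lra. }
    assert (Hh0 : h n 0 = phi 0).
    { unfold h; rewrite RInt_point; unfold zero; simpl; ring. }
    rewrite Hh0 in Heq.
    replace (h n x - phi x) with ((m n c - phi' c) * (x - 0)) by lra.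
    rewrite Rminus_0_r, Rabs_mult.
    assert (Hle : Rabs (m n c - phi' c) * Rabs x <= e' * M).
    { apply Rmult_le_compat; try apply Rabs_pos; [apply Herr; lra|easy]. }
    lra.
  + apply Rle_lt_trans with (1 := Herr x HxM).
    assert (0 <= e' * M) by (apply Rmult_le_pos; lra); lra.
Qed.

(** * Extension of the formula *)

Lemma slope_secant r s f : slope r s f * (r - s) = f r - f s.
Proof.
unfold slope; destruct (Req_EM_T r s) as [<-|H]; [ring|field; lra].
Qed.

(** The chain rule for divided differences; injectivity of g keeps distinct nodes distinct, so both
    sides fall in the same case of [slope]. *)
Lemma slope_comp r s f g : BL_plus f -> BL_plus g ->
  slope r s (fun x => f (g x)) = slope r s g * slope (g r) (g s) f.
Proof.
intros Hf Hg; unfold slope; destruct (Req_EM_T r s) as [<-|H].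
- destruct (Req_EM_T (g r) (g r)) as [_|]; [|easy].
  now apply is_derive_unique, is_derive_BL_comp.
- assert (Hne : g r <> g s).
  { destruct (Rtotal_order r s) as [Hl|[He|Hl]];
      [|easy|]; apply (BL_plus_increasing g Hg) in Hl; lra. }
  destruct (Req_EM_T (g r) (g s)) as [|_]; [easy|]; field; lra.
Qed.

Lemma slope_pos r s f : BL_plus f -> 0 < slope r s f.
Proof.
intros Hf; unfold slope; destruct (Req_EM_T r s) as [<-|H].
- destruct (BL_plus_elim f Hf) as [b [B [Hb [_ [_ H]]]]]; specialize (H r); lra.
- destruct (Rtotal_order r s) as [Hl|[He|Hl]]; [|easy|];
    assert (Hi := BL_plus_increasing f Hf _ _ Hl).
  + replace ((f r - f s) / (r - s)) with ((f s - f r) / (s - r)) by (field; lra).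
    apply Rdiv_lt_0_compat; lra.
  + apply Rdiv_lt_0_compat; lra.
Qed.

Lemma slope_affine r s k m : slope r s (fun x => k * x + m) = k.
Proof.
unfold slope; destruct (Req_EM_T r s) as [<-|H].
- apply is_derive_unique; auto_derive; [easy|ring].
- field; lra.
Qed.

(** Both formulas are [f p + d (z - p)], the affine interpolant of f at p and p - alpha y evaluated
    at z = x + i y, since x - p = - a y. *)
Lemma calE_eq_slope a alpha f x y : 0 < y ->
  let p := x + a * y in
  let d := slope p (p - alpha * y) f in
  calE a alpha f (x, y) = (f p - a * y * d, y * d).
Proof.
intros Hy p d; unfold calE; destruct (Req_EM_T alpha 0) as [->|Ha].
- unfold d, slope; replace (p - 0 * y) with p by ring.
  destruct (Req_EM_T p p) as [_|]; [|easy].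
  apply C_eq_components; unfold calE_zero, p; simpl; ring.
- assert (Hne : alpha * y <> 0) by (apply Rmult_integral_contrapositive; lra).
  unfold d, slope; destruct (Req_EM_T p (p - alpha * y)) as [|_]; [lra|].
  unfold calE_pos; apply C_eq_components; simpl;
    replace (x - (alpha - a) * y) with (p - alpha * y) by (unfold p; ring);
    fold p; field; lra.
Qed.

(** If p and q are the nodes attached to z, those attached to [calE a alpha g z] are [g p] and
    [g q]: the first by cancellation of the terms in a, the second because [d (p - q) = g p - g q].
    The chain rule for divided differences does the rest. *)
Lemma calE_comp a alpha f g z : BL_plus f -> BL_plus g -> UH z ->
  UH (calE a alpha g z) /\ calE a alpha f (calE a alpha g z) = calE a alpha (fun x => f (g x)) z.
Proof.
intros Hf Hg; destruct z as [x y]; unfold UH; simpl; intros Hy.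
rewrite !(calE_eq_slope _ _ _ x y) by easy.
set (p := x + a * y); set (q := p - alpha * y); set (d := slope p q g).
assert (Hd : 0 < y * d) by (apply Rmult_lt_0_compat; [easy|now apply slope_pos]).
split; [easy|].
rewrite calE_eq_slope by easy.
assert (Hsec := slope_secant p q g); fold d in Hsec.
replace (g p - a * y * d + a * (y * d)) with (g p) by ring.
replace (g p - alpha * (y * d)) with (g q).
- rewrite (slope_comp p q f g Hf Hg); fold d; f_equal; ring.
- replace (alpha * (y * d)) with (d * (p - q)) by (unfold q; ring); lra.
Qed.

Lemma calE_affine a alpha k m z : UH z ->
  calE a alpha (fun x => k * x + m) z = (RtoC k * z + RtoC m)%C.
Proof.
destruct z as [x y]; unfold UH; simpl; intros Hy.
rewrite calE_eq_slope, slope_affine by easy.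
apply C_eq_components; simpl; ring.
Qed.

Lemma slope_limit fn f r s : cvg_BL_plus fn f ->
  is_lim_seq (fun n => fn n r) (f r) /\
  is_lim_seq (fun n => slope r s (fn n)) (slope r s f).
Proof.
intros [_ [_ [H1 [H2 _]]]].
assert (pt : forall gn g x, cvg_unif_compact gn g -> is_lim_seq (fun n => gn n x) (g x)).
{ intros gn g x H; apply is_lim_seq_spec; intros eps.
  destruct (H (fun c => x <= c <= x) (compact_P3 x x) eps (cond_pos eps)) as [N HN].
  exists N; intros n Hn; apply HN; [easy|lra]. }
split; [now apply pt|].
unfold slope; destruct (Req_EM_T r s) as [Heq|Hne].
- now apply (pt (fun n => Derive (fn n))).
- apply (is_lim_seq_mult' _ (fun _ => / (r - s)));
    [|apply is_lim_seq_const].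
  apply is_lim_seq_minus'; now apply pt.
Qed.

(** * From small perturbations at [z0] to all maps and all points *)

Section Extension.

Variables (E : (R -> R) -> C -> C) (z0 : C) (eps0 a alpha : R).
Hypothesis HE : admissible_extension E.
Hypothesis Hz0 : UH z0.
Hypothesis Heps0 : 0 < eps0 < 1.
Hypothesis base : forall phi, B_infty eps0 phi ->
  E (fun x => x + phi x) z0 = calE a alpha (fun x => x + phi x) z0.

Lemma E_UH f z : BL_plus f -> UH z -> UH (E f z).
Proof. intros Hf; destruct HE as [H _]; destruct (H f Hf) as [G [HG _]]; apply HG. Qed.

Lemma E_comp f g z : BL_plus f -> BL_plus g -> UH z ->
  E (fun x => f (g x)) z = E f (E g z).
Proof. intros Hf Hg; destruct HE as [_ [_ [_ [H _]]]]; now apply H. Qed.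

Lemma E_affine k m z : 0 < k -> UH z ->
  E (fun x => k * x + m) z = calE a alpha (fun x => k * x + m) z.
Proof.
intros Hk Hz; rewrite calE_affine by easy.
destruct HE as [_ [_ [H _]]]; now apply H.
Qed.

Lemma formula_limit fn f : cvg_BL_plus fn f ->
  (forall n, E (fn n) z0 = calE a alpha (fn n) z0) -> E f z0 = calE a alpha f z0.
Proof.
intros Hcvg H.
assert (Hlim : is_lim_seq (fun n => Re (E (fn n) z0)) (Re (E f z0)) /\
               is_lim_seq (fun n => Im (E (fn n) z0)) (Im (E f z0))).
{ destruct HE as [_ [_ [_ [_ H4]]]].
  apply (is_lim_seq_C_components (fun n => E (fn n) z0)), (H4 _ _ Hcvg z0 Hz0). }
revert Hlim; generalize Hz0; destruct z0 as [x y] eqn:Ez; unfold UH; simpl; intros Hy [HRe HIm].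
set (p := x + a * y); set (q := p - alpha * y).
destruct (slope_limit fn f p q Hcvg) as [H1 H2].
rewrite calE_eq_slope by easy; fold p; fold q.
apply C_eq_components; simpl.
- apply is_lim_seq_unique in HRe.
  assert (HR : is_lim_seq (fun n => Re (E (fn n) (x, y))) (f p - a * y * slope p q f)).
  { apply is_lim_seq_ext with (fun n => fn n p - a * y * slope p q (fn n)).
    - intros n; now rewrite H, calE_eq_slope by easy.
    - apply is_lim_seq_minus'; [easy|]; now apply (is_lim_seq_scal_l _ _ (Finite _)). }
  apply is_lim_seq_unique in HR; rewrite HRe in HR; now injection HR.
- apply is_lim_seq_unique in HIm.
  assert (HR : is_lim_seq (fun n => Im (E (fn n) (x, y))) (y * slope p q f)).
  { apply is_lim_seq_ext with (fun n => y * slope p q (fn n)).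
    - intros n; now rewrite H, calE_eq_slope by easy.
    - now apply (is_lim_seq_scal_l _ _ (Finite _)). }
  apply is_lim_seq_unique in HR; rewrite HIm in HR; now injection HR.
Qed.

Lemma exists_affine_transport w : UH w ->
  exists k m, 0 < k /\ w = (RtoC k * z0 + RtoC m)%C.
Proof.
unfold UH in *; intros Hw; exists (Im w / Im z0), (Re w - Im w / Im z0 * Re z0); split.
- now apply Rdiv_lt_0_compat.
- apply C_eq_components; unfold Re, Im in *; simpl; field; lra.
Qed.

(* With A(x) = k x + m, the formula for A^-1 o f o A at [z0] gives it for f at A [z0]. *)
Lemma formula_transport f g k m : BL_plus f -> BL_plus g -> 0 < k ->
  (forall x, f (k * x + m) = k * g x + m) ->
  E g z0 = calE a alpha g z0 ->
  E f (RtoC k * z0 + RtoC m)%C = calE a alpha f (RtoC k * z0 + RtoC m)%C.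
Proof.
intros Hf Hg Hk Hconj Hz.
assert (HA := BL_plus_affine k m Hk).
rewrite <- (calE_affine a alpha k m z0 Hz0).
rewrite <- (E_affine k m z0 Hk Hz0) at 1.
rewrite (proj2 (calE_comp a alpha f _ z0 Hf HA Hz0)), <- (E_comp f _ z0 Hf HA Hz0).
replace (fun x => f (k * x + m)) with (fun x => k * g x + m)
  by (apply functional_extensionality; intros x; now rewrite Hconj).
rewrite (E_comp (fun x => k * x + m) g z0 HA Hg Hz0).
rewrite E_affine by (try easy; now apply E_UH).
rewrite Hz; now apply calE_comp.
Qed.

(** Compact support is removed by truncating [h]: the truncations satisfy [base], and the formula
    survives the limit. *)
Lemma formula_smooth_perturbation K e h :
  (forall x, Rabs (Derive plateau x) <= K) -> e * (1 + 3 * K) < eps0 -> 0 < e ->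
  smooth h -> (forall x, Rabs (Derive h x) <= e) ->
  E (fun x => x + h x) z0 = calE a alpha (fun x => x + h x) z0.
Proof.
intros HK HeK He Sh Hh.
destruct (nfloor_ex (Rabs (h 0) / e)) as [N [_ HN]].
{ apply Rmult_le_pos; [apply Rabs_pos|left; now apply Rinv_0_lt_compat]. }
assert (H0 : Rabs (h 0) <= e * (INR N + 1)).
{ replace (Rabs (h 0)) with (e * (Rabs (h 0) / e)) by (field; lra).
  apply Rmult_le_compat_l; lra. }
apply (formula_limit _ _ (cvg_BL_plus_cut K N h e HK Sh Hh H0 ltac:(lra))).
intros n; apply base, B_infty_intro with (e * (1 + 3 * K)); [now apply Cc_infty_cut| |easy].
apply Derive_cut_bound; try easy.
apply Rle_trans with (1 := H0), Rmult_le_compat_l; [lra|].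
rewrite plus_INR; generalize (pos_INR n); lra.
Qed.

(** Smooth approximation lowers the regularity to C^1 at [z0]. An affine conjugate [gt] of g
    satisfies [gt'(x) = g'(k x + m)], hence the same slope bound, so a single [e] works at every
    point z. *)
Lemma formula_near_identity : exists e, 0 < e < 1 /\ forall g, BL_plus g ->
  (forall x, Rabs (Derive g x - 1) <= e) ->
  forall z, UH z -> E g z = calE a alpha g z.
Proof.
destruct plateau_slope_bound as [K [HK HKb]].
set (e := eps0 / (2 * (1 + 3 * K))).
assert (He : 0 < e) by (apply Rdiv_lt_0_compat; lra).
assert (HeK : e * (1 + 3 * K) = eps0 / 2) by (unfold e; field; lra).
assert (He1 : e < 1) by (assert (0 < e * (3 * K)) by (apply Rmult_lt_0_compat; lra); lra).
exists e; split; [easy|].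
assert (Hat : forall g, BL_plus g -> (forall x, Rabs (Derive g x - 1) <= e) ->
          E g z0 = calE a alpha g z0).
{ intros g Hg Hge; set (phi := fun x => g x - x).
  assert (Hd : forall x, is_derive phi x (Derive g x - 1)).
  { intros x; apply (is_derive_minus g (fun x => x));
      [now apply BL_plus_is_derive|apply @is_derive_id]. }
  assert (Hdc : forall x, continuous (fun x => Derive g x - 1) x).
  { intros x; apply (continuous_minus (Derive g) (fun _ => 1));
      [apply Hg|apply continuous_const]. }
  destruct (smooth_C1_approximation phi _ e Hd Hdc Hge) as [h [Sh [Hh Hcv]]].
  apply formula_limit with (fun n x => x + h n x).
  - apply (cvg_BL_plus_intro _ (fun n x => 1 + Derive (h n) x) _ (Derive g) (1 - e) (1 + e));
      [lra| | |].
    + intros n; split; [|split].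
      * intros x; apply (is_derive_plus (fun x : R => x) (h n) x 1);
          [apply @is_derive_id|now apply smooth_is_derive].
      * intros x; apply (continuous_plus (fun _ : R => 1) (Derive (h n)));
          [apply continuous_const|now apply smooth_continuous, smooth_Derive].
      * intros x; generalize (proj1 (Rabs_le_between _ _) (Hh n x)); lra.
    + split; [now apply BL_plus_is_derive|split; [apply Hg|]].
      intros x; generalize (proj1 (Rabs_le_between _ _) (Hge x)); lra.
    + intros M eps Heps; destruct (Hcv M eps Heps) as [N HN]; exists N; intros n Hn x Hx.
      destruct (HN n Hn x Hx) as [HN1 HN2]; unfold phi in HN1.
      replace (x + h n x - g x) with (h n x - (g x - x)) by ring.
      replace (1 + Derive (h n) x - Derive g x) with (Derive (h n) x - (Derive g x - 1))
        by ring; easy.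
  - intros n; apply (formula_smooth_perturbation K e); try easy; lra. }
intros g Hg Hge z Hz; destruct (exists_affine_transport z Hz) as [k [m [Hk ->]]].
set (gt := fun x => / k * g (k * x + m) + - m * / k).
assert (HBL : BL_plus gt).
{ apply (BL_plus_comp (fun y => / k * y + - m * / k) (fun x => g (k * x + m))).
  - apply BL_plus_affine; now apply Rinv_0_lt_compat.
  - apply BL_plus_comp; [easy|now apply BL_plus_affine]. }
apply formula_transport with gt; try easy.
- intros x; unfold gt; field; lra.
- apply Hat; [easy|]; intros x.
  replace (Derive gt x) with (Derive g (k * x + m)); [apply Hge|].
  symmetry; apply is_derive_unique; unfold gt.
  auto_derive; [|change (fun x : R => g x) with g; field; lra].
  exists (Derive g (k * x + m)); now apply BL_plus_is_derive.
Qed.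

(* Interpolate linearly from Id to f; consecutive interpolants differ by a map
   with derivative close to 1. *)
Lemma formula_everywhere f z : BL_plus f -> UH z -> E f z = calE a alpha f z.
Proof.
intros Hf Hz.
destruct formula_near_identity as [e [He Hnear]].
destruct (BL_plus_elim f Hf) as [b [B [Hb [H1 [H2 H3]]]]].
(* All interpolants between Id and f have slopes that are convex combinations of 1 and f', hence at
   least [c]. *)
set (c := Rmin b 1).
assert (Hc : 0 < c) by (apply Rmin_pos; lra).
assert (Hcb : c <= b) by apply Rmin_l; assert (Hc1 : c <= 1) by apply Rmin_r.
assert (HB : 0 < B) by (generalize (H3 0); lra).
(* One step changes the slope by [(f' - 1) / N], against a slope of at least [c]: a relative change
   of at most [(B + 1) / (N * c)], which this number of steps brings down to [e]. *)
destruct (nfloor_ex ((B + 1) / (c * e))) as [N0 [_ HN0]].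
{ left; apply Rdiv_lt_0_compat; [lra|apply Rmult_lt_0_compat; lra]. }
set (N := INR N0 + 1) in HN0.
assert (HN : 0 < N) by apply INR_succ_pos.
assert (Hsmall : B + 1 <= e * (N * c)).
{ apply Rmult_le_reg_r with (/ (c * e)).
  - apply Rinv_0_lt_compat, Rmult_lt_0_compat; lra.
  - replace (e * (N * c) * / (c * e)) with N by (field; lra); left; exact HN0. }
set (F := fun j x => (1 - INR j / N) * x + INR j / N * f x).
assert (HFd : forall j x, is_derive (F j) x ((1 - INR j / N) + INR j / N * Derive f x)).
{ intros j x; apply (is_derive_plus (fun x : R => (1 - INR j / N) * x) (fun x => INR j / N * f x)).
  - auto_derive; [easy|ring].
  - now apply (is_derive_scal f x (INR j / N)). }
assert (Hj : forall j, (j <= S N0)%nat -> 0 <= INR j / N <= 1).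
{ intros j Hle; apply le_INR in Hle; rewrite S_INR in Hle; fold N in Hle.
  split; [apply Rmult_le_pos; [apply pos_INR|left; now apply Rinv_0_lt_compat]|].
  apply Rmult_le_reg_r with N; [easy|]; unfold Rdiv.
  rewrite Rmult_assoc, Rinv_l; lra. }
assert (HFb : forall j, (j <= S N0)%nat -> forall x,
  c <= (1 - INR j / N) + INR j / N * Derive f x <= 1 + B).
{ intros j Hle x; specialize (Hj j Hle); specialize (H3 x); nra. }
assert (HFBL : forall j, (j <= S N0)%nat -> BL_plus (F j)).
{ intros j Hle; apply (BL_plus_intro c (1 + B) _
    (fun x => (1 - INR j / N) + INR j / N * Derive f x));
    [easy|]; split; [apply HFd|split; [|now apply HFb]].
  intros x; apply (continuous_plus (fun _ : R => 1 - INR j / N) (fun x => INR j / N * Derive f x));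
    [apply continuous_const|].
  apply (continuous_mult (fun _ : R => INR j / N) (Derive f)); [apply continuous_const|apply H2]. }
assert (Hind : forall j, (j <= S N0)%nat -> forall w, UH w -> E (F j) w = calE a alpha (F j) w).
{ induction j as [|j IH]; intros Hle w Hw.
  - replace (F 0%nat) with (fun x : R => 1 * x + 0)
      by (apply functional_extensionality; intros x; unfold F; simpl; field; lra).
    apply E_affine; [lra|easy].
  - assert (Hlej : (j <= S N0)%nat) by lia.
    destruct (BL_plus_inverse (F j) (HFBL j Hlej)) as [G [HG [HFG [HGF HGd]]]].
    assert (HFS := HFBL (S j) Hle).
    assert (Hg := BL_plus_comp (F (S j)) G HFS HG).
    set (g := fun y => F (S j) (G y)) in Hg.
    assert (Heq : F (S j) = (fun x => g (F j x))).
    { apply functional_extensionality; intros x; unfold g; now rewrite HGF. }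
    rewrite Heq, E_comp by (try easy; now apply HFBL).
    rewrite IH by easy.
    destruct (calE_comp a alpha g (F j) w Hg (HFBL j Hlej) Hw) as [HU <-].
    apply Hnear; try easy.
    intros y; set (x := G y).
    assert (HD : is_derive g y
      (/ Derive (F j) x * ((1 - INR (S j) / N) + INR (S j) / N * Derive f x))).
    { apply (is_derive_comp (F (S j)) G); [apply HFd|apply HGd]. }
    replace (Derive g y) with
      (/ Derive (F j) x * ((1 - INR (S j) / N) + INR (S j) / N * Derive f x))
      by (symmetry; exact (is_derive_unique _ _ _ HD)).
    rewrite (is_derive_unique _ _ _ (HFd j x)).
    assert (Hbj := HFb j Hlej x); set (D := 1 - INR j / N + INR j / N * Derive f x) in *.
    assert (HND : 0 < N * D) by (apply Rmult_lt_0_compat; lra).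
    assert (HNDeq : N * D = N - INR j + INR j * Derive f x) by (unfold D; field; lra).
    replace (/ D * (1 - INR (S j) / N + INR (S j) / N * Derive f x) - 1)
      with ((Derive f x - 1) * / (N * D)) by (rewrite S_INR; unfold D; field; lra).
    rewrite Rabs_mult, (Rabs_pos_eq (/ (N * D))) by (left; now apply Rinv_0_lt_compat).
    apply Rmult_le_reg_r with (N * D); [easy|].
    rewrite Rmult_assoc, Rinv_l, Rmult_1_r by lra.
    apply Rle_trans with (B + 1).
    + specialize (H3 x); apply Rabs_le_between; lra.
    + apply Rle_trans with (1 := Hsmall).
      apply Rmult_le_compat_l; [lra|]; apply Rmult_le_compat_l; lra. }
replace f with (F (S N0)); [now apply Hind|].
apply functional_extensionality; intros x; unfold F; rewrite S_INR; fold N; field; lra.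
Qed.

End Extension.

Lemma slope_perturbation r s phi : smooth phi ->
  slope r s (fun x => x + phi x) = 1 + slope r s phi.
Proof.
intros Hphi; unfold slope; destruct (Req_EM_T r s) as [_|H].
- apply is_derive_unique, (is_derive_plus (fun x : R => x) phi r 1);
    [apply @is_derive_id|now apply smooth_is_derive].
- field; lra.
Qed.

Theorem theorem1 (E : (R -> R) -> C -> C)
  (HE : admissible_extension E)
  (z0 : C) (Hz0 : UH z0)
  (eps0 : R) (Heps0 : 0 < eps0 < 1)
  (L : (R -> R) -> C) (HL : linear_functional L)
  (Hlin : forall phi : R -> R, B_infty eps0 phi ->
     E (fun x => x + phi x) z0 = (z0 + L phi)%C) :
  exists a alpha : R, 0 <= alpha /\
    forall f : R -> R, BL_plus f ->
    forall z : C, UH z -> E f z = calE a alpha f z.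
Proof.
destruct (L_interpolation E z0 eps0 L HE Hz0 Heps0 HL Hlin) as [r [s [Hrs HLrs]]].
assert (Hy : 0 < Im z0) by exact Hz0.
(* Chosen so that the two nodes of [calE] attached to [z0] are exactly r and s; the ordering of the
   roots gives [alpha >= 0]. *)
exists ((r - Re z0) / Im z0), ((r - s) / Im z0); split.
- apply Rmult_le_pos; [lra|left; now apply Rinv_0_lt_compat].
- intros f Hf z Hz; apply (formula_everywhere E z0 eps0); try easy.
  intros phi Hphi; rewrite Hlin by easy.
  assert (Cphi := proj1 Hphi); destruct (HLrs phi Cphi) as [HRe HIm].
  destruct z0 as [x y]; simpl in *.
  rewrite calE_eq_slope by easy.
  replace (x + (r - x) / y * y) with r by (field; lra).
  replace (r - (r - s) / y * y) with s by (field; lra).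
  rewrite slope_perturbation by now apply Cc_infty_iff.
  apply C_eq_components; simpl.
  + change (fst (L phi)) with (Re (L phi)); rewrite HRe; field; lra.
  + change (snd (L phi)) with (Im (L phi)); rewrite HIm; field; lra.
Qed.
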